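(* Let $V$ be a vertex operator algebra with two commuting automorphisms $g_1,g_2$ of finite order, and set $g_3=g_1g_2$. Let $W^1$ and $W^2$ be $C_1$-cofinite generalized $g_1$-twisted and $g_2$-twisted $V$-modules, respectively. Then $(W^1\Diamond W^2,\mathcal{Y}^{\diamond})\in\mathcal{F}_{(W^1,W^2)}$ (that is, $W^1\Diamond W^2$, with the vertex operators $Y_{\mathcal{S}}(-,x)$, is a generalized $g_3$-twisted $V$-module and $\mathcal{Y}^\diamond$ is a surjective twisted logarithmic intertwining operator of type $\binom{W^1\Diamond W^2}{W^1\ W^2}$), and $(W^1\Diamond W^2,\mathcal{Y}^{\diamond})$ is the fusion product of $W^1$ and $W^2$.
   Context: Vertex operator algebras $(V,Y,\mathbf 1,\omega)$ are over $\mathbb{C}$, in the standard (Frenkel-Huang-Lepowsky) sense; $\mathbb{N}$ contains $0$. Twisted modules. Let $g$ be an automorphism of $V$ of finite order $T$, and let $V^{(g,r)}=\{v\in V\mid gv=e^{-2\pi \mathrm{i} r/T}v\}$, $0\le r\le T-1$. A weak $g$-twisted $V$-module (also called $g$-twisted $V$-module) is a vector space $W$ with a linear map $Y_W(-,x):V\to \mathrm{End}(W)[[x^{1/T},x^{-1/T}]]$, $v\mapsto Y_W(v,x)=\sum_{n\in\frac1T\mathbb{Z}}v_nx^{-n-1}$, such that: $Y_W(\mathbf 1,x)=\mathrm{id}_W$; $Y_W(u,x)w\in x^{r/T}W((x))$ for $u\in V^{(g,r)}$, $w\in W$; and for $v\in V^{(g,r)}$, $u\in V$, $$x_0^{-1}\delta\left(\tfrac{x_1-x_2}{x_0}\right)Y_W(v,x_1)Y_W(u,x_2)-x_0^{-1}\delta\left(\tfrac{x_2-x_1}{-x_0}\right)Y_W(u,x_2)Y_W(v,x_1)=x_1^{-1}\delta\left(\tfrac{x_2+x_0}{x_1}\right)\left(\tfrac{x_2+x_0}{x_1}\right)^{-r/T}Y_W(Y(v,x_0)u,x_2).$$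 Write $Y_W(\omega,x)=\sum_n L(n)x^{-n-2}$ and $W_{(\lambda)}=\{w\in W\mid (L(0)-\lambda)^kw=0\text{ for some }k\in\mathbb{N}\}$. A generalized $g$-twisted $V$-module is a weak one with $W=\bigoplus_{\lambda\in\mathbb{C}}W_{(\lambda)}$ such that for each $\lambda\in\mathbb{C}$, $W_{(\lambda+n/T)}=0$ for all sufficiently negative integers $n$. $C_1$-cofiniteness. $C_1(W)$ is the span of all $v_{-1}w$ with $v\in V^{(g,0)}$ homogeneous, $\mathrm{wt}\,v>0$, $w\in W$, together with all $v_{-1-r/T}w$ with $v\in V^{(g,r)}$ homogeneous, $r=1,\dots,T-1$, $\mathrm{wt}\,v\ge 0$, $w\in W$. $W$ is $C_1$-cofinite if $\dim W/C_1(W)<\infty$. Twisted logarithmic intertwining operators. Let $T_k$ be the order of $g_k$ ($k=1,2,3$) and $V^{(r_1,r_2)}=\{v\mid g_kv=e^{-2\pi \mathrm{i} r_k/T_k}v,\ k=1,2\}$ for $0\le r_k<T_k$. For $g_k$-twisted modules $W^k$, a twisted logarithmic intertwining operator of type $\binom{W^3}{W^1\ W^2}$ is a linear map $\mathcal{Y}(-,x):W^1\otimes W^2\to W^3[\log x]\{x\}$, $\mathcal{Y}(w^1,x)w^2=\sum_{n\in\mathbb{C}}\sum_{k\in\mathbb{N}}(w^1)^{\mathcal{Y}}_{n;k}w^2\,x^{-n-1}(\log x)^k$ ($\{x\}$ denotes formal series in arbitrary complex powers of $x$) such that: (i) for all $w^1,w^2$ and $h\in\mathbb{C}$, $(w^1)^{\mathcal{Y}}_{h+n;k}w^2=0$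 for $n\in\mathbb{N}$ sufficiently large, independently of $k$; (ii) for $v\in V^{(r_1,r_2)}$, $$x_0^{-1}\delta\left(\tfrac{x_1-x_2}{x_0}\right)\left(\tfrac{x_1-x_2}{x_0}\right)^{-r_1/T_1}Y_{W^3}(v,x_1)\mathcal{Y}(w^1,x_2)w^2-x_0^{-1}\delta\left(\tfrac{-x_2+x_1}{x_0}\right)\left(\tfrac{-x_2+x_1}{x_0}\right)^{-r_1/T_1}\mathcal{Y}(w^1,x_2)Y_{W^2}(v,x_1)w^2$$ $$=x_1^{-1}\delta\left(\tfrac{x_2+x_0}{x_1}\right)\left(\tfrac{x_2+x_0}{x_1}\right)^{-r_2/T_2}\mathcal{Y}(Y_{W^1}(v,x_0)w^1,x_2)w^2,$$ where $(-x)^\alpha$ means $e^{\pi \mathrm{i}\alpha}x^\alpha$; (iii) $\mathcal{Y}(L(-1)w^1,x)=\frac{d}{dx}\mathcal{Y}(w^1,x)$. $\mathcal{I}\binom{W^3}{W^1\ W^2}$ denotes the space of these operators. $\mathrm{Im}\,\mathcal{Y}$ is the span of all coefficients $(w^1)^{\mathcal{Y}}_{n;k}w^2$, and $\mathcal{Y}$ is surjective if $\mathrm{Im}\,\mathcal{Y}=W^3$. $\mathcal{F}_{(W^1,W^2)}$ is the set of pairs $(U,\mathcal{Y})$ with $U$ a generalized $g_3$-twisted $V$-module and $\mathcal{Y}\in\mathcal{I}\binom{U}{W^1\ W^2}$ surjective, modulo: $(U,\mathcal{Y}_1)\cong(W,\mathcal{Y}_2)$ if there is an isomorphism $f:U\to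 W$ of $g_3$-twisted $V$-modules with $f\circ\mathcal{Y}_1=\mathcal{Y}_2$. (The isomorphism classes form a set; below one representative is used for each class.) Fusion product. A fusion product of $W^1$ and $W^2$ is a pair $(W^1\boxtimes W^2,\mathcal{Y}^{\boxtimes})$ with $W^1\boxtimes W^2$ a generalized $g_3$-twisted $V$-module and $\mathcal{Y}^{\boxtimes}\in\mathcal{I}\binom{W^1\boxtimes W^2}{W^1\ W^2}$ such that for every generalized $g_3$-twisted $V$-module $W$ and every $\mathcal{Y}\in\mathcal{I}\binom{W}{W^1\ W^2}$ there is a unique $g_3$-twisted $V$-module homomorphism $\phi:W^1\boxtimes W^2\to W$ with $\mathcal{Y}=\phi\circ\mathcal{Y}^{\boxtimes}$. The construction. Let $\mathcal{S}=\prod_{(U,\mathcal{Y})\in\mathcal{F}_{(W^1,W^2)}}U$ (direct product of vector spaces), with componentwise operators $Y_{\mathcal{S}}(v,x)=\prod_{(U,\mathcal{Y})}Y_U(v,x)$ for $v\in V$. For $w^1\in W^1$, $w^2\in W^2$, $n\in\mathbb{C}$, $k\in\mathbb{N}$, let $(w^1)^{\diamond}_{n;k}w^2\in\mathcal{S}$ be the element whose $(U,\mathcal{Y})$-component is $(w^1)^{\mathcal{Y}}_{n;k}w^2$. Let $W^1\Diamond W^2\subset\mathcal{S}$ be the linear span of all $(w^1)^{\diamond}_{n;k}w^2$, and $$\mathcal{Y}^{\diamond}(w^1,x)w^2=\sum_{n\in\mathbb{C},\,k\in\mathbb{N}}(w^1)^{\diamond}_{n;k}w^2\,x^{-n-1}(\log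 x)^k .$$ *)

(* Defs.v *)
(* The field of complex numbers is R[i], for R : realType.

   A vertex operator Y(v,x) = \sum_n v_n x^{-n-1} is given by its modes: the
   endomorphism v_n is [Y v n].  An identity between formal series is the
   equality of the coefficients of every monomial.  The sums over i : nat below
   come from binomial expansions in nonnegative powers of the second variable;
   they are the finite-support sums of fsbigop, and the truncation axioms make
   all but finitely many of their terms vanish. *)
From HB Require Import structures.
From mathcomp Require Import all_boot all_order all_algebra.
From mathcomp Require Import mathcomp_extra boolp classical_sets functions.
From mathcomp Require Import cardinality fsbigop reals topology normedtype trigo.
From mathcomp Require Import complex.

Set Implicit Arguments.
Unset Strict Implicit.
Unset Printing Implicit Defensive.

Import Order.TTheory GRing.Theory Num.Theory.

Local Open Scope classical_set_scope.
Local Open Scope ring_scope.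

Section LinearAlgebra.
Variable K : fieldType.

Definition linspan (W : lmodType K) (A : set W) : set W :=
  [set w | exists s : seq (K * W),
     (forall p, p \in s -> A p.2) /\ w = \sum_(p <- s) p.1 *: p.2].

Definition subspace (W : lmodType K) (A : set W) : Prop :=
  [/\ A 0, forall u v, A u -> A v -> A (u + v)
    & forall (a : K) u, A u -> A (a *: u)].

Definition finite_dim (W : lmodType K) (A : set W) : Prop :=
  exists s : seq W, A `<=` linspan [set` s].

(* dim W / A < oo, for a subspace A *)
Definition finite_codim (W : lmodType K) (A : set W) : Prop :=
  exists s : seq W, forall w, exists a, A a /\ linspan [set` s] (w - a).

Definition direct_sum_decomposition (I : eqType) (W : lmodType K)
    (U : I -> set W) : Prop :=
  [/\ forall i, subspace (U i),
      forall w, exists (s : seq I) (f : I -> W),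
        (forall i, U i (f i)) /\ w = \sum_(i <- s) f i
    & forall (s : seq I) (f : I -> W), uniq s -> (forall i, U i (f i)) ->
        \sum_(i <- s) f i = 0 -> forall i, i \in s -> f i = 0].

Definition gen_eigenspace (W : lmodType K) (L : W -> W) (lambda : K) : set W :=
  [set w | exists k : nat, iter k (fun x => L x - lambda *: x) w = 0].

Definition binom (a : K) (i : nat) : K :=
  (\prod_(j < i) (a - j%:R)) / (i`!)%:R.

Definition dprod (I : Type) (U : I -> lmodType K) : Type := forall i, U i.

Section DProd.
Variables (I : Type) (U : I -> lmodType K).
HB.instance Definition _ := gen_eqMixin (dprod U).
HB.instance Definition _ := gen_choiceMixin (dprod U).
Let add (s t : dprod U) : dprod U := fun i => s i + t i.
Let opp (s : dprod U) : dprod U := fun i => - s i.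
Let zero : dprod U := fun i => 0.
Let scale (a : K) (s : dprod U) : dprod U := fun i => a *: s i.
Fact dprod_addA : associative add.
Proof. by move=> s t u; apply: functional_extensionality_dep => i; exact: addrA. Qed.
Fact dprod_addC : commutative add.
Proof. by move=> s t; apply: functional_extensionality_dep => i; exact: addrC. Qed.
Fact dprod_add0 : left_id zero add.
Proof. by move=> s; apply: functional_extensionality_dep => i; exact: add0r. Qed.
Fact dprod_addN : left_inverse zero opp add.
Proof. by move=> s; apply: functional_extensionality_dep => i; exact: addNr. Qed.
HB.instance Definition _ := GRing.isZmodule.Build (dprod U)
  dprod_addA dprod_addC dprod_add0 dprod_addN.
Fact dprod_scaleA a b (s : dprod U) : scale a (scale b s) = scale (a * b) s.
Proof. by apply: functional_extensionality_dep => i; exact: scalerA. Qed.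
Fact dprod_scale1 : left_id 1 scale.
Proof. by move=> s; apply: functional_extensionality_dep => i; exact: scale1r. Qed.
Fact dprod_scaleDr : right_distributive scale +%R.
Proof. by move=> a s t; apply: functional_extensionality_dep => i; exact: scalerDr. Qed.
Fact dprod_scaleDl s : {morph scale^~ s : a b / a + b}.
Proof. by move=> a b; apply: functional_extensionality_dep => i; exact: scalerDl. Qed.
HB.instance Definition _ := GRing.Zmodule_isLmodule.Build K (dprod U)
  dprod_scaleA dprod_scale1 dprod_scaleDr dprod_scaleDl.
End DProd.

Lemma linspan_subset (W : lmodType K) (A : set W) : A `<=` linspan A.
Proof.
move=> w Aw; exists [:: (1, w)]; split; last by rewrite big_seq1 scale1r.
by move=> p; rewrite inE => /eqP ->.
Qed.

Section SpanType.
Variables (W : lmodType K) (A : set W).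

Definition in_span : {pred W} := fun w => `[< linspan A w >].

Fact in_span_submod : submod_closed in_span.
Proof.
split=> [|a u v /asboolP [s [sA ->]] /asboolP [t [tA ->]]]; apply/asboolP.
  by exists [::]; split=> //; rewrite big_nil.
exists ([seq (a * p.1, p.2) | p <- s] ++ t); split=> [p|].
  rewrite mem_cat => /orP [/mapP [q qs ->]|]; [exact: (sA q qs) | exact: tA].
rewrite big_cat big_map scaler_sumr; congr (_ + _).
by apply: eq_bigr => p _; rewrite scalerA.
Qed.

HB.instance Definition _ := GRing.isSubmodClosed.Build K W in_span in_span_submod.

(* the span of A, as a vector space on its own *)
Record span_of := SpanOf { span_val :> W; _ : span_val \in in_span }.
HB.instance Definition _ := [isSub for span_val].
HB.instance Definition _ := [Choice of span_of by <:].
HB.instance Definition _ := [SubChoice_isSubLmodule of span_of by <:].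

Fact mem_in_span w : A w -> w \in in_span.
Proof. by move=> Aw; apply/asboolP; exact: linspan_subset. Qed.
End SpanType.

End LinearAlgebra.

Section TwistedModules.
Variable R : realType.
Local Notation C := R[i].

(* e^{pi i a} *)
Definition expipi (a : rat) : C :=
  Complex (cos (pi * ratr a : R)) (sin (pi * ratr a : R)).

(* voa_gr n is the weight space V_(n), and L(n) = omega_{n+1}.  In voa_jacobi,
   u and v are the vectors carried by x1 and x2, and the identity is the
   coefficient of x0^{-l-1} x1^{-m-1} x2^{-n-1}. *)
Record voa := VOA {
  voa_sort :> lmodType C;
  voa_gr : int -> set voa_sort;
  voa_Y : voa_sort -> int -> voa_sort -> voa_sort;
  voa_vac : voa_sort;
  voa_omega : voa_sort;
  voa_rank : C;
  voa_gr_sum : direct_sum_decomposition voa_gr;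
  voa_gr_fin : forall n, finite_dim (voa_gr n);
  voa_gr_low : exists N : int, forall n, n < N -> voa_gr n `<=` [set 0];
  voa_Y_linear_l : forall n v, linear (fun u => voa_Y u n v);
  voa_Y_linear_r : forall u n, linear (voa_Y u n);
  voa_Y_trunc : forall u v, exists N : int, forall n, N <= n -> voa_Y u n v = 0;
  voa_vac_gr : voa_gr 0 voa_vac;
  voa_omega_gr : voa_gr 2 voa_omega;
  voa_vacuum : forall n v, voa_Y voa_vac n v = if n == -1 then v else 0;
  voa_creation : forall v (n : int), -1 <= n ->
    voa_Y v n voa_vac = if n == -1 then v else 0;
  voa_jacobi : forall (u v w : voa_sort) (l m n : int),
    \sum_(i \in [set: nat]) ((-1) ^+ i * binom l%:~R i) *:
        voa_Y u (m + l - i%:Z) (voa_Y v (n + i%:Z) w)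
    - \sum_(i \in [set: nat]) ((-1) ^ l * ((-1) ^+ i * binom l%:~R i)) *:
        voa_Y v (n + l - i%:Z) (voa_Y u (m + i%:Z) w)
    = \sum_(i \in [set: nat]) binom m%:~R i *:
        voa_Y (voa_Y u (l + i%:Z) v) (m + n - i%:Z) w;
  voa_virasoro : forall (m n : int) v,
    voa_Y voa_omega (m + 1) (voa_Y voa_omega (n + 1) v)
    - voa_Y voa_omega (n + 1) (voa_Y voa_omega (m + 1) v)
    = (m - n)%:~R *: voa_Y voa_omega (m + n + 1) v
      + (if m + n == 0 then (m ^+ 3 - m)%:~R / 12%:R * voa_rank else 0) *: v;
  voa_L0 : forall n v, voa_gr n v -> voa_Y voa_omega 1 v = n%:~R *: v;
  (* (d/dx) Y(v,x) = Y(L(-1)v,x), coefficient of x^{-n-1} *)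
  voa_Lm1 : forall v n u,
    voa_Y (voa_Y voa_omega 0 v) n u = - n%:~R *: voa_Y v (n - 1) u
}.

Definition voa_automorphism (V : voa) (g : V -> V) : Prop :=
  [/\ linear g, bijective g,
      forall u n v, g (voa_Y u n v) = voa_Y (g u) n (g v),
      g (voa_vac V) = voa_vac V & g (voa_omega V) = voa_omega V].

Definition is_order (T : Type) (g : T -> T) (n : nat) : Prop :=
  [/\ (0 < n)%N, iter n g =1 id
    & forall k, (0 < k < n)%N -> ~ (iter k g =1 id)].

Definition finite_order (T : Type) (g : T -> T) : Prop :=
  exists n, (0 < n)%N /\ iter n g =1 id.

(* the order of g, or 0 if g has infinite order *)
Definition ord_of (T : Type) (g : T -> T) : nat := xget 0%N (is_order g).

Lemma ord_ofP (T : Type) (g : T -> T) :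
  finite_order g -> is_order g (ord_of g).
Proof.
move=> [n0 hn0]; rewrite /ord_of; case: xgetP => [//|noT].
have ex : exists n, `[< (0 < n)%N /\ iter n g =1 id >].
  by exists n0; apply/asboolP.
case: (ex_minnP ex) => n /asboolP [n_gt0 gn] nmin.
case: (noT n); split=> // k /andP [k_gt0 ltkn] gk.
by have := nmin k (asboolT (conj k_gt0 gk)); rewrite leqNgt ltkn.
Qed.

(* V^{(g,r)} *)
Definition twist_space (V : voa) (g : V -> V) (r : nat) : set V :=
  [set v | g v = expipi (- (2%:R * r%:R / (ord_of g)%:R)) *: v].

(* Modes are indexed by rat, with v_n = 0 unless n \in (1/T)Z.  tw_jacobi is
   the coefficient of x0^{-l-1} x1^{-m-1} x2^{-n-1}, with
     x1^{-1} delta((x2+x0)/x1) ((x2+x0)/x1)^{-r/T}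
       = \sum_(m \in -r/T + Z) x1^{-m-1} (x2+x0)^m. *)
Record weak_twisted_module (V : voa) (g : V -> V) (W : lmodType C)
    (Y : V -> rat -> W -> W) : Prop := WeakTwistedModule {
  tw_linear_l : forall n w, linear (fun v => Y v n w);
  tw_linear_r : forall v n, linear (Y v n);
  tw_support : forall v n w,
    (ord_of g)%:R * n \isn't a Num.int -> Y v n w = 0;
  tw_vacuum : forall n w, Y (voa_vac V) n w = if n == -1 then w else 0;
  (* Y(u,x)w \in x^{r/T} W((x)) *)
  tw_coset : forall (r : nat) u n w, (r < ord_of g)%N -> twist_space g r u ->
    n + r%:R / (ord_of g)%:R \isn't a Num.int -> Y u n w = 0;
  tw_trunc : forall (r : nat) u w, (r < ord_of g)%N -> twist_space g r u ->
    exists N : rat, forall n, N <= n -> Y u n w = 0;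
  tw_jacobi : forall (r : nat) v u w (l : int) (m n : rat),
    (r < ord_of g)%N -> twist_space g r v ->
    \sum_(i \in [set: nat]) ((-1) ^+ i * binom l%:~R i) *:
        Y v (m + l%:~R - i%:R) (Y u (n + i%:R) w)
    - \sum_(i \in [set: nat]) ((-1) ^ l * ((-1) ^+ i * binom l%:~R i)) *:
        Y u (n + l%:~R - i%:R) (Y v (m + i%:R) w)
    = if m + r%:R / (ord_of g)%:R \is a Num.int then
        \sum_(i \in [set: nat]) binom (ratr m) i *:
          Y (voa_Y v (l + i%:Z) u) (m + n - i%:R) w
      else 0
}.

(* L(n) on a twisted module *)
Definition Lop (V : voa) (W : lmodType C) (Y : V -> rat -> W -> W) (n : int) :
  W -> W := Y (voa_omega V) (n%:~R + 1).

Record generalized_twisted_module (V : voa) (g : V -> V) (W : lmodType C)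
    (Y : V -> rat -> W -> W) : Prop := GeneralizedTwistedModule {
  gtm_weak : weak_twisted_module g Y;
  gtm_sum : direct_sum_decomposition (gen_eigenspace (Lop Y 0));
  gtm_low : forall lambda : C, exists N : int, forall n : int, n <= N ->
    gen_eigenspace (Lop Y 0) (lambda + n%:~R / (ord_of g)%:R) `<=` [set 0]
}.

Record gtwmod (V : voa) (g : V -> V) := GTwMod {
  gtw_sort :> lmodType C;
  gtw_Y : V -> rat -> gtw_sort -> gtw_sort;
  gtw_axioms : generalized_twisted_module g gtw_Y
}.

Definition C1_space (V : voa) (g : V -> V) (W : lmodType C)
    (Y : V -> rat -> W -> W) : set W :=
  linspan
    ([set x | exists v w (n : int),
        [/\ twist_space g 0 v, voa_gr n v, 0 < n & x = Y v (-1) w]]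
     `|`
     [set x | exists (r : nat) v w (n : int),
        [/\ (1 <= r < ord_of g)%N, twist_space g r v, voa_gr n v, 0 <= n
          & x = Y v (-1 - r%:R / (ord_of g)%:R) w]]).

Definition C1_cofinite (V : voa) (g : V -> V) (W : gtwmod g) : Prop :=
  finite_codim (C1_space g (@gtw_Y V g W)).

Definition twisted_hom (V : voa) (U W : lmodType C)
    (YU : V -> rat -> U -> U) (YW : V -> rat -> W -> W) (f : U -> W) : Prop :=
  linear f /\ forall v n u, f (YU v n u) = YW v n (f u).

(* [Z w1 n k w2] is the coefficient of x^{-n-1} (log x)^k in Z(w1,x)w2.
   io_jacobi is the coefficient of
     x0^{-l-1} x1^{-m-1} x2^{-n-1} (log x2)^k.
   With a = r1/T1, the two scalar series on its left-hand side are
     x0^{-1} delta((x1-x2)/x0) ((x1-x2)/x0)^{-a}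
       = \sum_(l \in -a + Z) x0^{-l-1} (x1-x2)^l,
     x0^{-1} delta((-x2+x1)/x0) ((-x2+x1)/x0)^{-a}
       = \sum_(l \in -a + Z) x0^{-l-1} (-x2+x1)^l,
   and (-x2)^{l-i} = e^{pi i (l-i)} x2^{l-i}. *)
Record intertwining_operator (V : voa) (g1 g2 : V -> V)
    (W1 W2 W3 : lmodType C) (Y1 : V -> rat -> W1 -> W1)
    (Y2 : V -> rat -> W2 -> W2) (Y3 : V -> rat -> W3 -> W3)
    (Z : W1 -> C -> nat -> W2 -> W3) : Prop := IntertwiningOperator {
  io_linear_l : forall n k w2, linear (fun w1 => Z w1 n k w2);
  io_linear_r : forall w1 n k, linear (Z w1 n k);
  (* the coefficient of each power of x is a polynomial in log x *)
  io_log : forall w1 w2 n, exists K : nat, forall k, (K <= k)%N ->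
    Z w1 n k w2 = 0;
  io_trunc : forall w1 w2 (h : C), exists N : nat, forall n k, (N <= n)%N ->
    Z w1 (h + n%:R) k w2 = 0;
  io_jacobi : forall (r1 r2 : nat) v w1 w2 (l m : rat) (n : C) (k : nat),
    (r1 < ord_of g1)%N -> (r2 < ord_of g2)%N ->
    twist_space g1 r1 v -> twist_space g2 r2 v ->
    (if l + r1%:R / (ord_of g1)%:R \is a Num.int then
       \sum_(i \in [set: nat]) ((-1) ^+ i * binom (ratr l) i) *:
         Y3 v (m + l - i%:R) (Z w1 (n + i%:R) k w2)
       - \sum_(i \in [set: nat]) (expipi (l - i%:R) * binom (ratr l) i) *:
         Z w1 (n + ratr l - i%:R) k (Y2 v (m + i%:R) w2)
     else 0)
    = if m + r2%:R / (ord_of g2)%:R \is a Num.int then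
        \sum_(i \in [set: nat]) binom (ratr m) i *:
          Z (Y1 v (l + i%:R) w1) (ratr m + n - i%:R) k w2
      else 0;
  (* Z(L(-1)w1,x) = (d/dx) Z(w1,x), coefficient of x^{-n-1} (log x)^k *)
  io_Lm1 : forall w1 n k w2,
    Z (Lop Y1 (-1) w1) n k w2
    = - n *: Z w1 (n - 1) k w2 + (k.+1)%:R *: Z w1 (n - 1) k.+1 w2
}.

Definition coefficients (W1 W2 W3 : Type) (Z : W1 -> C -> nat -> W2 -> W3) :
    set W3 :=
  [set w | exists w1 n k w2, w = Z w1 n k w2].

Definition surjective_op (W1 W2 W3 : lmodType C)
    (Z : W1 -> C -> nat -> W2 -> W3) : Prop :=
  linspan (coefficients Z) = setT.

Section Fusion.
Variables (V : voa) (g1 g2 : V -> V) (W1 : gtwmod g1) (W2 : gtwmod g2).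
Local Notation g3 := (g1 \o g2).
Local Notation intertwining YW Z :=
  (intertwining_operator g1 g2 (@gtw_Y V g1 W1) (@gtw_Y V g2 W2) YW Z).

(* (W, YW, Z) is a pair whose class belongs to F_(W1,W2) *)
Definition fusion_pair (W : lmodType C) (YW : V -> rat -> W -> W)
    (Z : W1 -> C -> nat -> W2 -> W) : Prop :=
  [/\ generalized_twisted_module g3 YW, intertwining YW Z & surjective_op Z].

Record fpair := FPair {
  fp_mod :> gtwmod g3;
  fp_op : W1 -> C -> nat -> W2 -> fp_mod;
  fp_axioms : fusion_pair (@gtw_Y V g3 fp_mod) fp_op
}.

Definition fpair_iso (p q : fpair) : Prop :=
  exists f : p -> q,
    [/\ twisted_hom (@gtw_Y V g3 p) (@gtw_Y V g3 q) f, bijective f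
      & forall w1 n k w2, f (fp_op p w1 n k w2) = fp_op q w1 n k w2].

(* a family containing exactly one representative of each isomorphism class *)
Definition representatives (I : Type) (F : I -> fpair) : Prop :=
  (forall p, exists i, fpair_iso p (F i))
  /\ (forall i j, fpair_iso (F i) (F j) -> i = j).

(* The isomorphism classes form a set: a class is determined by the linear
   relations between the coefficients of the operator, together with the action
   of V expressed on these coefficients. *)
Let word := seq (C * (W1 * C * nat * W2)).
Let ev (p : fpair) (s : word) : p :=
  \sum_(t <- s) t.1 *: fp_op p t.2.1.1.1 t.2.1.1.2 t.2.1.2 t.2.2.
Let code (p : fpair) : (word -> word -> Prop) * (V -> rat -> word -> word -> Prop) :=
  (fun s s' => ev p s = ev p s',
   fun v n s s' => gtw_Y v n (ev p s) = ev p s').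

Let ev_surj p u : {s | ev p s = u}.
Proof.
apply: cid; have [_ _ surj] := fp_axioms p.
have [s [sA ->]] : linspan (coefficients (fp_op p)) u by rewrite surj.
elim: s sA => [|a s IHs] sA; first by exists [::]; rewrite /ev !big_nil.
have [|s' es'] := IHs; first by move=> t ts; apply: sA; rewrite inE ts orbT.
have [w1 [n [k [w2 e]]]] := sA a (mem_head _ _).
by exists ((a.1, (w1, n, k, w2)) :: s'); rewrite /ev !big_cons -/(ev p s') es' e.
Qed.

Let ev_hom (p q : fpair) (f : p -> q) s : linear f ->
  (forall w1 n k w2, f (fp_op p w1 n k w2) = fp_op q w1 n k w2) ->
  f (ev p s) = ev q s.
Proof.
move=> lf fZ; have f0 : f 0 = 0.
  by have := lf (-1) 0 0; rewrite addr0 scaler0 scaleN1r addNr.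
rewrite /ev; elim: s => [|a s IHs]; first by rewrite !big_nil.
by rewrite !big_cons lf fZ IHs.
Qed.

Let code_iso p q : fpair_iso p q -> code p = code q.
Proof.
move=> [f [[lf fY] bf fZ]]; have fI := bij_inj bf.
have E s : f (ev p s) = ev q s by exact: ev_hom.
rewrite /code; congr pair; apply/funext.
  move=> s; apply/funext => s'; apply/propext; rewrite -!E.
  by split=> [->//|/fI].
move=> v; apply/funext => n; apply/funext => s; apply/funext => s'.
apply/propext; rewrite -!E -fY.
by split=> [->//|/fI].
Qed.

Let iso_code p q : code p = code q -> fpair_iso p q.
Proof.
move=> pq.
have E1 s s' : (ev p s = ev p s') = (ev q s = ev q s').
  by have := congr1 (fun c => c.1 s s') pq.
have E2 v n s s' :
    (gtw_Y v n (ev p s) = ev p s') = (gtw_Y v n (ev q s) = ev q s').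
  by have := congr1 (fun c => c.2 v n s s') pq.
pose f (u : p) : q := ev q (sval (ev_surj u)).
have fE s : f (ev p s) = ev q s.
  by rewrite /f -E1; case: (ev_surj (ev p s)).
pose g (u : q) : p := ev p (sval (ev_surj u)).
have ev_lin (r : fpair) a s s' :
    ev r ([seq (a * t.1, t.2) | t <- s] ++ s') = a *: ev r s + ev r s'.
  rewrite /ev big_cat big_map scaler_sumr; congr (_ + _).
  by apply: eq_bigr => t _; rewrite scalerA.
have op1 (r : fpair) w1 n k w2 : fp_op r w1 n k w2 = ev r [:: (1, (w1, n, k, w2))].
  by rewrite /ev big_seq1 scale1r.
exists f; split; first split.
- move=> a u u'; case: (ev_surj u) => s <-; case: (ev_surj u') => s' <-.
  by rewrite -ev_lin !fE ev_lin.
- move=> v n u; case: (ev_surj u) => s <-.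
  case: (ev_surj (gtw_Y v n (ev p s))) => s' es'.
  by rewrite -es' !fE; apply/esym; rewrite -E2.
- exists g => u.
    case: (ev_surj u) => s <-; rewrite fE /g E1.
    by case: (ev_surj (ev q s)).
  by rewrite /g fE; case: ev_surj.
by move=> w1 n k w2; rewrite !op1 fE.
Qed.

Lemma representatives_exist :
  exists (I : Type) (F : I -> fpair), representatives F.
Proof.
pose F (i : {c | exists p, code p = c}) : fpair := sval (cid (svalP i)).
have codeF i : code (F i) = sval i by rewrite /F; case: cid.
exists {c | exists p, code p = c}, F; split=> [p|i j /code_iso].
  exists (exist _ (code p) (ex_intro _ p erefl)).
  by apply: iso_code; rewrite codeF.
by rewrite !codeF => /eq_sig_hprop; apply=> c x y; exact: Prop_irrelevance.
Qed.

Definition is_fusion_product (W : lmodType C) (YW : V -> rat -> W -> W)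
    (Z : W1 -> C -> nat -> W2 -> W) : Prop :=
  [/\ generalized_twisted_module g3 YW, intertwining YW Z
    & forall (M : gtwmod g3) (Z' : W1 -> C -> nat -> W2 -> M),
        intertwining (@gtw_Y V g3 M) Z' ->
        exists! phi : W -> M,
          twisted_hom YW (@gtw_Y V g3 M) phi
          /\ forall w1 n k w2, Z' w1 n k w2 = phi (Z w1 n k w2)].

Section Diamond.
Variables (I : Type) (F : I -> fpair).

Definition S_prod : lmodType C := dprod (fun i => F i : lmodType C).

Definition S_Y (v : V) (n : rat) (s : S_prod) : S_prod :=
  fun i => gtw_Y v n (s i).

Definition S_coef (w1 : W1) (n : C) (k : nat) (w2 : W2) : S_prod :=
  fun i => fp_op (F i) w1 n k w2.

Definition diamond : lmodType C := span_of (coefficients S_coef).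

Definition diamond_val (d : diamond) : S_prod := span_val d.

(* the restriction of S_Y to the span; insubd gives 0 on a vector that S_Y
   sends out of the span *)
Definition diamond_Y (v : V) (n : rat) (d : diamond) : diamond :=
  insubd (0 : span_of (coefficients S_coef)) (S_Y v n (diamond_val d)).

Definition diamond_op (w1 : W1) (n : C) (k : nat) (w2 : W2) : diamond :=
  SpanOf (mem_in_span
    (ex_intro _ w1 (ex_intro _ n (ex_intro _ k (ex_intro _ w2 erefl)))
      : coefficients S_coef (S_coef w1 n k w2))).

End Diamond.
End Fusion.
End TwistedModules.

Arguments diamond_Y {R V g1 g2 W1 W2 I} F v n d.
Arguments diamond_op {R V g1 g2 W1 W2 I} F w1 n k w2.

(* Main.v *)
(* Let Z be a surjective operator into U.  When w1 = v_{-1-r1/T1} w, or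
   w2 = v_{-1-r2/T2} w, the Jacobi identity expresses the coefficients of
   Z(w1,x)w2 modulo C_1(U) through pairs of strictly smaller total weight, with
   scalars that do not depend on (U,Z).  By descent, all coefficients reduce to
   those of finitely many homogeneous pairs, namely representatives of
   W1/C_1(W1) and W2/C_1(W2).  Let E_k be the column of the coefficients of
   (log x)^k of these pairs, at the powers of x for which they have weight mu in
   U.  Reducing the pairs (L(-1)w1, w2) turns the L(-1)-derivative property into
     (k+1) E_{k+1} = (A - mu) E_k   modulo C_1(U),
   where the matrix A depends only on W1 and W2.  As E_k = 0 for large k, the
   weights of U/C_1(U) are eigenvalues of A, and the powers of log x are bounded
   modulo C_1(U).  Generators of C_1(U) raise weights by positive multiples of
   1/T3, so that the weights of U lie in spec(A) + N/T3 and, by induction on the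
   weight, L(0) - mu is nilpotent of bounded order on U_(mu), uniformly in (U,Z).

   Uniformity is what makes the direct product work: truncation holds
   simultaneously in all components, so that the span of the coefficients is
   stable under V and is a generalized twisted module.  For the universal
   property, the image of an arbitrary operator is itself isomorphic to one of
   the factors of the product. *)
Require Import Defs.
From mathcomp Require Import all_boot all_order all_algebra.
From mathcomp Require Import boolp classical_sets reals complex.
From mathcomp Require Import fsbigop trigo.
From mathcomp Require Import ring lra zify.

Set Implicit Arguments.
Unset Strict Implicit.
Unset Printing Implicit Defensive.

Import Order.TTheory GRing.Theory Num.Theory.

Local Open Scope classical_set_scope.
Local Open Scope ring_scope.

(** * Linear algebra *)

Section LinearFunctions.
Variables (K : fieldType) (U W : lmodType K) (f : U -> W).
Hypothesis lf : linear f.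

Lemma lin0 : f 0 = 0.
Proof. by have := lf (-1) 0 0; rewrite addr0 scaler0 scaleN1r addNr. Qed.

Lemma linD u v : f (u + v) = f u + f v.
Proof. by rewrite -[u in LHS]scale1r lf scale1r. Qed.

Lemma linZ a u : f (a *: u) = a *: f u.
Proof. by rewrite -[a *: u]addr0 lf lin0 addr0. Qed.

Lemma linN u : f (- u) = - f u.
Proof. by rewrite -scaleN1r linZ scaleN1r. Qed.

Lemma linB u v : f (u - v) = f u - f v.
Proof. by rewrite linD linN. Qed.

Lemma lin_sum (X : Type) (s : seq X) (P : pred X) (F : X -> U) :
  f (\sum_(x <- s | P x) F x) = \sum_(x <- s | P x) f (F x).
Proof. by apply: (big_morph f linD lin0). Qed.

End LinearFunctions.

Lemma fsum_nat (W : nmodType) (F : nat -> W) N :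
  (forall i, (N <= i)%N -> F i = 0) ->
  \sum_(i \in [set: nat]) F i = \sum_(i < N) F i.
Proof.
move=> F0; rewrite fsbig_ord; apply/esym/fsbig_widen => //.
by move=> i [_ /negP]; rewrite -leqNgt => /F0.
Qed.

Lemma fsum_nat0 (W : nmodType) (F : nat -> W) :
  (forall i, F i = 0) -> \sum_(i \in [set: nat]) F i = 0.
Proof. by move=> F0; apply: fsbig1 => i _. Qed.

Section Subspaces.
Variables (K : fieldType) (W : lmodType K).
Implicit Types A P : set W.

Lemma subspace_sum P (X : eqType) (s : seq X) (c : pred X) (F : X -> W) :
  subspace P -> (forall x, x \in s -> c x -> P (F x)) ->
  P (\sum_(x <- s | c x) F x).
Proof.
case=> P0 PD _ PF; rewrite big_seq_cond; apply: big_ind => //.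
by move=> x /andP [xs cx]; exact: PF.
Qed.

Lemma subspaceN P u : subspace P -> P u -> P (- u).
Proof. by case=> _ _ PZ Pu; rewrite -scaleN1r; exact: PZ. Qed.

Lemma subspaceB P u v : subspace P -> P u -> P v -> P (u - v).
Proof. by move=> sP Pu Pv; case: (sP) => _ PD _; apply: PD => //; exact: subspaceN. Qed.

Lemma linspan_is_subspace A : subspace (linspan A).
Proof.
have [h0 hD] := in_span_submod A; split=> [|u v Au Av|a u Au]; apply/asboolP.
- exact: h0.
- by rewrite -[u]scale1r; apply: hD; apply/asboolP.
by rewrite -[_ *: _]addr0; apply: hD; [apply/asboolP|exact: h0].
Qed.

Lemma linspan_sub A P : subspace P -> A `<=` P -> linspan A `<=` P.
Proof.
move=> sP AP w [s [sA ->]]; apply: subspace_sum => // p ps _.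
by have [_ _ PZ] := sP; apply: PZ; apply: AP; exact: sA.
Qed.

Lemma linspan_mono A A' : A `<=` A' -> linspan A `<=` linspan A'.
Proof.
move=> AA'; apply: linspan_sub; first exact: linspan_is_subspace.
by apply: (subset_trans AA'); exact: linspan_subset.
Qed.

Lemma linspan_idem A : linspan (linspan A) `<=` linspan A.
Proof. by apply: linspan_sub => //; exact: linspan_is_subspace. Qed.

Lemma subspace_preim (U : lmodType K) (f : U -> W) P :
  linear f -> subspace P -> subspace [set u | P (f u)].
Proof.
move=> lf [P0 PD PZ]; split=> /= [|u v|a u]; first by rewrite (lin0 lf).
  by rewrite (linD lf); exact: PD.
by rewrite (linZ lf); exact: PZ.
Qed.

Lemma subspace0 : subspace [set (0 : W)].
Proof.
split=> //= [u v -> ->|a u ->]; first by rewrite addr0.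
by rewrite scaler0.
Qed.

Lemma subspaceI A P : subspace A -> subspace P -> subspace (A `&` P).
Proof.
move=> [A0 AD AZ] [P0 PD PZ]; split=> // [u v [? ?] [? ?]|a u [? ?]].
  by split; [exact: AD|exact: PD].
by split; [exact: AZ|exact: PZ].
Qed.

Section Graded.
Variables (I : eqType) (U : I -> set W).
Hypothesis dU : direct_sum_decomposition U.

Lemma graded_ind P : subspace P -> (forall i, U i `<=` P) -> forall w, P w.
Proof.
have [_ gen _] := dU => sP UP w; have [s [f [fU ->]]] := gen w.
by apply: subspace_sum => // i _ _; exact: UP.
Qed.

(** Independence is stated for one vector per index, so the terms are first collected by weight,
    with [w] subtracted at index [l]. The collected vectors [h i] add up to zero, hence [h l]
    vanishes. *)
Lemma graded_proj (X : eqType) (s : seq X) (kap : X -> I) (f : X -> W) l w :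
  U l w -> (forall x, x \in s -> U (kap x) (f x)) ->
  w = \sum_(x <- s) f x -> w = \sum_(x <- s | kap x == l) f x.
Proof.
have [sU _ indep] := dU => Uw Uf Ew.
pose h i := (\sum_(x <- s | kap x == i) f x) - (if i == l then w else 0).
have hl : l \in undup (l :: map kap s) by rewrite mem_undup mem_head.
have := indep (undup (l :: map kap s)) h (undup_uniq _) _ _ l hl.
rewrite /h eqxx => h0; apply/esym/subr0_eq/h0 => [i|].
  apply: subspaceB => //.
    by apply: subspace_sum => // x xs /eqP <-; exact: Uf.
  by case: eqP => [->//|_]; have [] := sU i.
rewrite sumrB (eq_bigr (fun i => \sum_(x <- s) if kap x == i then f x else 0)); last first.
  by move=> i _; rewrite big_mkcond.
have uI i : i \in undup (l :: map kap s) ->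
    [seq j <- undup (l :: map kap s) | j == i] = [:: i].
  by move=> iI; rewrite filter_pred1_uniq // undup_uniq.
have -> : \sum_(i <- undup (l :: map kap s)) (if i == l then w else 0) = w.
  by rewrite -big_mkcond -big_filter uI ?big_seq1.
rewrite exchange_big /= Ew; apply/eqP; rewrite subr_eq0; apply/eqP.
apply: eq_big_seq => x xs; rewrite -big_mkcond -big_filter.
rewrite (eq_filter (a2 := pred1 (kap x))) => [|i]; last by rewrite /= eq_sym.
by rewrite uI ?big_seq1 // mem_undup inE map_f ?orbT.
Qed.

Lemma graded_span (G : I -> set W) l w : (forall i, G i `<=` U i) -> U l w ->
  linspan [set x | exists i, G i x] w -> linspan (G l) w.
Proof.
have [sU _ _] := dU => GU Uw [s [sG Ew]].
have [kap hkap] : exists kap : K * W -> I, forall p, p \in s -> G (kap p) p.2.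
  have : forall p : K * W, exists i, p \in s -> G i p.2.
    move=> p; have [ps|] := boolP (p \in s); last by exists l.
    by have [i Gi] := sG p ps; exists i.
  by case/choice => kap h; exists kap.
have -> : w = \sum_(p <- s | kap p == l) p.1 *: p.2.
  apply: graded_proj Ew => // p ps; have [_ _ UZ] := sU (kap p).
  by apply: UZ; apply: GU; exact: hkap.
apply: subspace_sum; first exact: linspan_is_subspace.
move=> p ps /eqP <-; have [_ _ LZ] := linspan_is_subspace (G (kap p)).
by apply: LZ; apply: linspan_subset; exact: hkap.
Qed.

End Graded.
End Subspaces.

(** * Generalized eigenvectors and powers of the logarithm *)

Section Nilpotency.
Variables (K : fieldType).

(** The operator iterated in [gen_eigenspace]: membership there unfolds to the vanishing of an
    iterate of [shift]. *)
Definition shift (W : lmodType K) (L : W -> W) (l : K) (w : W) : W := L w - l *: w.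

Lemma shift_linear (W : lmodType K) (L : W -> W) l :
  linear L -> linear (shift L l).
Proof.
move=> lL a u v; rewrite /shift lL scalerBr scalerDr scalerA mulrC -scalerA.
by rewrite opprD addrACA.
Qed.

Lemma iter_linear (W : lmodType K) (L : W -> W) k : linear L -> linear (iter k L).
Proof. by move=> lL; elim: k => [|k IHk] a u v //=; rewrite IHk lL. Qed.

Lemma iter_lin0_ge (W : lmodType K) (L : W -> W) j k w : linear L ->
  (j <= k)%N -> iter j L w = 0 -> iter k L w = 0.
Proof.
move=> lL jk w0; rewrite -(subnK jk) iterD w0.
exact: lin0 (iter_linear _ lL).
Qed.

Lemma iter_stable (W : lmodType K) (L : W -> W) (P : set W) k w :
  (forall u, P u -> P (L u)) -> P w -> P (iter k L w).
Proof. by move=> PL Pw; elim: k => //= k; exact: PL. Qed.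

Lemma ker_iter_subspace (W : lmodType K) (L : W -> W) k : linear L ->
  subspace [set w | iter k L w = 0].
Proof.
by move=> lL; exact: subspace_preim (iter_linear k lL) (@subspace0 K W).
Qed.

Lemma gen_eigenspace_subspace (W : lmodType K) (L : W -> W) l :
  linear L -> subspace (gen_eigenspace L l).
Proof.
move=> lL; have lS := shift_linear l lL; split.
- by exists 0%N.
- move=> u v [j hu] [k hv]; exists (maxn j k); rewrite -/(shift L l).
  rewrite (linD (iter_linear _ lS)) (iter_lin0_ge lS (leq_maxl _ _) hu).
  by rewrite (iter_lin0_ge lS (leq_maxr _ _) hv) addr0.
move=> a u [j hu]; exists j; rewrite -/(shift L l).
by rewrite (linZ (iter_linear _ lS)) hu scaler0.
Qed.

Lemma gen_eigenspace_shift (W : lmodType K) (L : W -> W) l w : linear L ->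
  gen_eigenspace L l w -> gen_eigenspace L l (shift L l w).
Proof.
move=> lL [k hk]; exists k; rewrite -/(shift L l) -iterSr /=.
by rewrite hk; exact: lin0 (shift_linear l lL).
Qed.

Lemma iter_intertwine (U W : Type) (f : U -> W) (D : U -> U) (E : W -> W) k u :
  (forall u, E (f u) = f (D u)) -> iter k E (f u) = f (iter k D u).
Proof. by move=> h; elim: k => //= k ->; rewrite h. Qed.

(* F k stands for the coefficient of (log x)^k of an intertwining operator, in
   its dependence on the two arguments; DF is the commutator formula of L(0). *)
Section TwoVariables.
Variables (W1 W2 W : lmodType K) (N1 : W1 -> W1) (N2 : W2 -> W2) (D : W -> W).
Variable F : nat -> W1 -> W2 -> W.
Hypotheses (F0l : forall k w2, F k 0 w2 = 0) (F0r : forall k w1, F k w1 0 = 0).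
Hypothesis lD : linear D.
Hypothesis DF : forall k w1 w2,
  D (F k w1 w2) = F k (N1 w1) w2 + F k w1 (N2 w2) + k.+1%:R *: F k.+1 w1 w2.

(** A pigeonhole argument: each application of [D] applies [N1], applies [N2] or raises the power of
    the logarithm. Among [p + q + s] applications, one of these occurs [p], [q] or [s] times
    respectively, which gives 0 or an element of [P]. It serves with [P] equal to {0} and to C_1. *)
Lemma derivation_nilpotent (P : set W) K0 p q s k w1 w2 : subspace P ->
  (forall w, P w -> P (D w)) ->
  (forall i j k, (K0 <= k)%N -> P (F k (iter i N1 w1) (iter j N2 w2))) ->
  iter p N1 w1 = 0 -> iter q N2 w2 = 0 -> (K0 <= k + s)%N ->
  P (iter (p + q + s) D (F k w1 w2)).
Proof.
move=> sP PD; have [P0 PA PZ] := sP; move En: (p + q + s)%N => n.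
elim: n p q s k w1 w2 En => [|n IHn] p q s k w1 w2 En hP hp hq hs.
  have -> : F k w1 w2 = 0 by rewrite (_ : w1 = 0) //; have := hp; rewrite (_ : p = 0%N) //; lia.
  by [].
case: p hp En => [/= -> _|p hp En].
  by rewrite F0l; exact: (iter_stable n.+1 PD P0).
case: q hq En => [/= -> _|q hq En].
  by rewrite F0r; exact: (iter_stable n.+1 PD P0).
case: s hs En => [hs _|s hs En].
  apply: (iter_stable n.+1 PD); apply: (hP 0%N 0%N); lia.
rewrite iterSr DF 2!(linD (iter_linear n lD)) (linZ (iter_linear n lD)).
apply: (PA); first apply: (PA).
- apply: (IHn p q.+1 s.+1); [lia| |by rewrite -iterSr|by []|by []].
  by move=> i j k' hk'; rewrite -iterSr; exact: hP.
- apply: (IHn p.+1 q s.+1); [lia| |by []|by rewrite -iterSr|by []].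
  by move=> i j k' hk'; rewrite -iterSr; exact: hP.
by apply: PZ; apply: (IHn p.+1 q.+1 s); [lia|..] => //; lia.
Qed.

Hypothesis K0 : forall k, k.+1%:R != 0 :> K.

(** [DF] is solved for [F k.+1], which expresses it through [F k] at the price of one application of
    [D], [N1] or [N2]; descending to [k = 0] reaches the hypothesis on [F 0]. The exponent [i]
    serves the induction, and the bound on the logarithmic degree is the case [i = 0]. *)
Lemma log_degree_bound p q m i k w1 w2 :
  (forall s t, iter m D (F 0 (iter s N1 w1) (iter t N2 w2)) = 0) ->
  iter p N1 w1 = 0 -> iter q N2 w2 = 0 -> (p + q + m <= k + i)%N ->
  iter i D (F k w1 w2) = 0.
Proof.
elim: k p q i w1 w2 => [|k IHk] p q i w1 w2 hm hp hq hi.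
  by apply: (iter_lin0_ge lD _ (hm 0%N 0%N)); lia.
have D0 := lin0 (iter_linear i lD).
case: p hp hi => [/= -> _|p hp hi]; first by rewrite F0l.
case: q hq hi => [/= -> _|q hq hi]; first by rewrite F0r.
apply: (scalerI (K0 k)); rewrite scaler0 -(linZ (iter_linear i lD)).
have -> : k.+1%:R *: F k.+1 w1 w2 =
    D (F k w1 w2) - F k (N1 w1) w2 - F k w1 (N2 w2).
  by rewrite DF -addrA -opprD addrC addKr.
rewrite 2!(linB (iter_linear i lD)) -iterSr.
have -> : iter i.+1 D (F k w1 w2) = 0 by apply: (IHk p.+1 q.+1) => //; lia.
have -> : iter i D (F k (N1 w1) w2) = 0.
  apply: (IHk p q.+1); [|by rewrite -iterSr|exact: hq|lia].
  by move=> s t; rewrite -iterSr; exact: hm.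
have -> : iter i D (F k w1 (N2 w2)) = 0.
  apply: (IHk p.+1 q); [|exact: hp|by rewrite -iterSr|lia].
  by move=> s t; rewrite -iterSr; exact: hm.
by rewrite !subr0.
Qed.

End TwoVariables.
End Nilpotency.

Lemma matrix_fitting (F : fieldType) (N : nat) (M : 'M[F]_N.+1) (mu : F) :
  exists (e : nat) (X : 'M[F]_N.+1),
    (M - mu%:M) ^+ e = X * (M - mu%:M) ^+ e.+1
    /\ (~~ root (char_poly M) mu -> e = 0%N).
Proof.
(* Cayley-Hamilton for char_poly M = q * ('X - mu)^e with q(mu) != 0. *)
have [e [q]] := multiplicity_XsubC (char_poly M) mu.
rewrite (monic_neq0 (char_poly_monic M)) /= => q0 Eq.
have [r Er] : exists r, q = r * ('X - mu%:P) + q.[mu]%:P.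
  have /factor_theorem [r Er] : root (q - q.[mu]%:P) mu.
    by rewrite rootE !hornerE subrr.
  by exists r; rewrite -Er subrK.
have := Cayley_Hamilton M; rewrite Eq rmorphM rmorphXn rmorphB /=.
rewrite horner_mx_X horner_mx_C => CH.
(* With q = r ('X - mu) + q(mu), Cayley-Hamilton reads (r(M) (M - mu) + q(mu)) (M - mu)^e = 0;
   solving for (M - mu)^e gives this X. *)
exists e, (- (q.[mu])^-1 *: horner_mx M r); split.
  apply/eqP; rewrite -subr_eq0; apply/eqP.
  have h : horner_mx M q = horner_mx M r * (M - mu%:M) + q.[mu]%:M.
    by rewrite {1}Er rmorphD rmorphM rmorphB /= horner_mx_X !horner_mx_C.
  rewrite h mulrDl in CH.
  apply: (scalerI q0); rewrite scaler0 scalerBr -scalerAl scalerA.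
  rewrite mulrN divff // scaleN1r opprK -[RHS]CH exprS mulrA addrC.
  by rewrite -mul_scalar_mx.
move=> nr; case: e {CH} Eq nr => // e Eq /negP [].
by rewrite exprS mulrA rootE !hornerE subrr !(mulr0, mul0r).
Qed.

Lemma lin_fsum (K : fieldType) (U W : lmodType K) (f : U -> W) (F : nat -> U) :
  linear f -> (exists N, forall i, (N <= i)%N -> F i = 0) ->
  f (\sum_(i \in [set: nat]) F i) = \sum_(i \in [set: nat]) f (F i).
Proof.
move=> lf [N hN]; rewrite (fsum_nat hN) (lin_sum lf) (fsum_nat (N := N)) // => i Ni.
by rewrite hN // (lin0 lf).
Qed.

Lemma span_decomposition (K : fieldType) (I : eqType) (W : lmodType K)
    (U : I -> set W) w : (forall i, subspace (U i)) ->
  linspan [set x | exists i, U i x] w ->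
  exists (s : seq I) (f : I -> W), (forall i, U i (f i)) /\ w = \sum_(i <- s) f i.
Proof.
move=> sU [t [tU Ew]].
(* [I] may be empty, so the default value [i0] of [kap] has to come from an element of [t]. *)
have [[p0 Up0]|t0] := pselect (exists p, p \in t); last first.
  have -> : w = 0.
    by rewrite Ew big1_seq // => p /andP [_ pt]; case: t0; exists p.
  by exists [::], (fun=> 0); split=> [i|]; [have [] := sU i|rewrite big_nil].
have [i0 _] := tU _ Up0.
have [kap hkap] : exists kap : K * W -> I, forall p, p \in t -> U (kap p) p.2.
  have : forall p : K * W, exists i, p \in t -> U i p.2.
    move=> p; have [pt|] := boolP (p \in t); last by exists i0.
    by have [i Ui] := tU p pt; exists i.
  by case/choice => kap h; exists kap.
exists (undup (map kap t)), (fun i => \sum_(p <- t | kap p == i) p.1 *: p.2).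
split=> [i|].
  apply: subspace_sum => // p pt /eqP <-; have [_ _ UZ] := sU (kap p).
  by apply: UZ; exact: hkap.
rewrite Ew (exchange_big_dep predT) //=; apply: eq_big_seq => p pt.
rewrite -big_filter (eq_filter (a2 := pred1 (kap p))) => [|i]; last by rewrite /= eq_sym.
by rewrite filter_pred1_uniq ?undup_uniq ?mem_undup ?map_f // big_seq1.
Qed.

(** * Eigenspaces of finite-order automorphisms *)

Section Twisting.
Variable R : realType.
Local Notation C := R[i].
Local Notation e := (@expipi R).

Lemma expipiD a b : e (a + b) = e a * e b.
Proof.
rewrite /expipi rmorphD /= mulrDr cosD sinD.
apply/eqP; rewrite eq_complex /=; apply/andP; split; apply/eqP; ring.
Qed.

Lemma expipi0 : e 0 = 1.
Proof. by rewrite /expipi rmorph0 mulr0 cos0 sin0. Qed.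

Lemma expipi2 : e 2%:R = 1.
Proof. by rewrite /expipi ratr_nat mulr_natr cos2pi sin2pi. Qed.

Lemma expipiX a n : e a ^+ n = e (a * n%:R).
Proof.
elim: n => [|n IHn]; first by rewrite mulr0 expipi0 expr0.
by rewrite exprS IHn -expipiD -natr1 mulrDr mulr1 addrC.
Qed.

Lemma expipiN a : e (- a) = (e a)^-1.
Proof.
have h : e a * e (- a) = 1 by rewrite -expipiD subrr expipi0.
have nz : e a != 0.
  by apply/eqP => z; move: h; rewrite z mul0r => /eqP; rewrite eq_sym oner_eq0.
by apply: (mulfI nz); rewrite h divff.
Qed.

Lemma expipi_even (n : int) : e (2%:R * n%:~R) = 1.
Proof.
have hn (m : nat) : e (2%:R * m%:R) = 1 by rewrite -expipiX expipi2 expr1n.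
case: n => n; first exact: hn.
by rewrite NegzE mulrNz mulrN expipiN hn invr1.
Qed.

(** Only the fractional part b of a matters. The real part of the equation, cos(2 pi b) = 1, forces
    sin(pi b) = 0, whereas the sine is positive on the open interval from 0 to pi. *)
Lemma expipi_eq1 a : e (2%:R * a) = 1 -> a \is a Num.int.
Proof.
move=> ea; rewrite -(subrK (Num.floor a)%:~R a) rpredD ?intr_int //.
set b := a - _; have eb : e (2%:R * b) = 1.
  by rewrite mulrBr expipiD ea mul1r expipiN expipi_even invr1.
have /andP [b0 b1] : 0 <= b < 1.
  have h := floor_itv a; rewrite /b; move: h; rewrite intrD; lra.
have [->|bn0] := eqVneq b 0; first exact: int_num0.
have bgt0 : 0 < b by rewrite lt_neqAle eq_sym bn0.
have s0 : 0 < sin (pi * ratr b : R).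
  apply: sin_gt0_pi; rewrite mulr_gt0 ?pi_gt0 ?ltr0q //=.
  by rewrite gtr_pMr ?pi_gt0 // -(rmorph1 (@ratr R)) ltr_rat.
move/eqP: eb; rewrite /expipi eq_complex /= => /andP [/eqP hc _].
move: hc; rewrite rmorphM /= ratr_nat mulrCA mulr_natl cos_mulr2n cos2sin2.
move=> hc; have : sin (pi * ratr b : R) ^+ 2 = 0 by move: hc; lra.
by move/eqP; rewrite sqrf_eq0 gt_eqF.
Qed.

Lemma expipi_sum (T j : nat) : (0 < T)%N -> (j < T)%N ->
  \sum_(r < T) e (2%:R * r%:R / T%:R * j%:R) = (if j == 0%N then T%:R else 0).
Proof.
move=> T0 jT; have Tn : (T%:R : rat) != 0 by rewrite pnatr_eq0 -lt0n.
have [->|j0] := eqVneq j 0%N.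
  rewrite (eq_bigr (fun=> 1)) => [|r _]; last by rewrite mulr0 expipi0.
  by rewrite sumr_const card_ord.
pose z := e (2%:R * (j%:R / T%:R)).
have z1 : z != 1.
  apply/eqP => /expipi_eq1 /intrP [m hm].
  have : (0 : rat) < (m%:~R : rat) < 1.
    rewrite -hm; apply/andP; split; first by rewrite divr_gt0 // ltr0n // lt0n.
    by rewrite ltr_pdivrMr ?ltr0n // mul1r ltr_nat.
  rewrite ltr0z -[1]/(1%:~R) ltr_int; lia.
have zT : z ^+ T = 1.
  by rewrite /z expipiX -mulrA divfK // -(expipi_even j).
have /eqP := subrX1 z T; rewrite zT subrr eq_sym mulf_eq0 subr_eq0 (negbTE z1) /=.
move=> /eqP h; rewrite -[RHS]h; apply: eq_bigr => r _; rewrite /z expipiX; congr e.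
by field.
Qed.

Section TwistSpaces.
Variables (V : voa R).

Lemma voa_gr_subspace n : subspace (@voa_gr _ V n).
Proof. by have [] := voa_gr_sum V. Qed.

(** For the converse of [voa_L0], comparing components of weight i gives (i - n) v_i = 0. Weights
    can then be read off from [L(0)], as is done for g v and L(-1) v. *)
Lemma voa_grP (v : V) (n : int) :
  voa_gr n v <-> voa_Y (voa_omega V) 1 v = n%:~R *: v.
Proof.
split; first exact: voa_L0.
have [sU gen indep] := voa_gr_sum V; move=> hv.
have [s [f [fU Ev]]] := gen v.
have lY := @voa_Y_linear_r _ V (voa_omega V) 1.
pose g i := \sum_(j <- s | j == i) f j.
have g0 i : i != n -> g i = 0.
  move=> ni; have : 0 = \sum_(j <- s | j == i) (j - n)%:~R *: f j.
    apply: (graded_proj (voa_gr_sum V) (kap := id)) => [|j _|].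
    - by have [] := sU i.
    - by have [_ _ UZ] := sU j; exact: UZ.
    have h : voa_Y (voa_omega V) 1 v - n%:~R *: v = 0 by rewrite hv subrr.
    rewrite -[LHS]h {1 2}Ev (lin_sum lY) scaler_sumr -sumrB; apply: eq_bigr => j _.
    by rewrite (voa_L0 (fU j)) -scalerBl intrB.
  rewrite (eq_bigr (fun j => (i - n)%:~R *: f j)) => [|j /eqP -> //].
  rewrite -scaler_sumr -/(g i) => /esym/eqP.
  by rewrite scaler_eq0 intr_eq0 subr_eq0 (negbTE ni) => /eqP.
have -> : v = \sum_(i <- undup s) g i.
  rewrite Ev (exchange_big_dep predT) //=; apply: eq_big_seq => j js.
  rewrite -big_filter (eq_filter (a2 := pred1 j)) => [|i]; last by rewrite /= eq_sym.
  by rewrite filter_pred1_uniq ?undup_uniq ?mem_undup // big_seq1.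
apply: subspace_sum => // i _ _; have [->|/g0 ->] := eqVneq i n.
  by apply: subspace_sum => // j _ /eqP <-.
by have [] := sU n.
Qed.

Lemma voa_auto_gr (g : V -> V) n v : voa_automorphism g ->
  voa_gr n v -> voa_gr n (g v).
Proof.
move=> [lg _ gY _ gw] /voa_L0 hv; apply/voa_grP.
by rewrite -{1}gw -gY hv (linZ lg).
Qed.

Lemma voa_Lm1_gr n (v : V) : voa_gr n v -> voa_gr (n + 1) (voa_Y (voa_omega V) 0 v).
Proof.
move=> hv; apply/voa_grP.
have := voa_virasoro 0 (-1) v; rewrite /= add0r addNr.
rewrite (voa_L0 hv) (linZ (@voa_Y_linear_r _ V _ _)).
rewrite scale0r addr0.
by move=> /eqP; rewrite subr_eq -scalerDl -intrD addrC => /eqP ->; congr (_%:~R *: _).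
Qed.

Lemma voa_Y2_vac (v : V) : voa_Y v (-2) (voa_vac V) = voa_Y (voa_omega V) 0 v.
Proof.
have := voa_Lm1 v (-1) (voa_vac V); rewrite voa_creation // eqxx => ->.
by rewrite opprK scale1r.
Qed.

Lemma voa_omega_twist (g : V -> V) : voa_automorphism g -> twist_space g 0 (voa_omega V).
Proof.
by move=> [_ _ _ _ h]; rewrite /twist_space /= h mulr0 mul0r oppr0 expipi0 scale1r.
Qed.

Lemma voa_Lm1_twist (g : V -> V) r (v : V) : voa_automorphism g ->
  twist_space g r v -> twist_space g r (voa_Y (voa_omega V) 0 v).
Proof.
move=> [_ _ gY _ gw]; rewrite /twist_space /= => hv.
by rewrite gY gw hv (linZ (@voa_Y_linear_r _ V _ _)).
Qed.

Lemma twist_space_subspace (g : V -> V) r : linear g -> subspace (twist_space g r).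
Proof.
move=> lg; rewrite /twist_space; split=> /= [|u v hu hv|a u hu].
- by rewrite (lin0 lg) scaler0.
- by rewrite (linD lg) hu hv scalerDr.
by rewrite (linZ lg) hu !scalerA mulrC.
Qed.

Lemma twist_space_comm (g h : V -> V) r v : linear h ->
  (forall u, g (h u) = h (g u)) -> twist_space g r v -> twist_space g r (h v).
Proof. by rewrite /twist_space /= => lh gh hv; rewrite gh hv (linZ lh). Qed.

(** A finite Fourier transform: v is the sum of the p_r = 1/T \sum_j e^{2 pi i r j / T} g^j v. Each
    p_r lies in V^{(g,r)}, and in [A] because [A] is a g-stable subspace. *)
Lemma twist_ind (g : V -> V) (A P : set V) : linear g -> finite_order g ->
  subspace A -> (forall v, A v -> A (g v)) -> subspace P ->
  (forall r v, (r < ord_of g)%N -> A v -> twist_space g r v -> P v) ->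
  forall v, A v -> P v.
Proof.
move=> lg /ord_ofP [T0 gT _] [A0 AD AZ] Ag sP AP v Av.
set T := ord_of g in T0 gT AP.
have Tn : (T%:R : C) != 0 by rewrite pnatr_eq0 -lt0n.
have Tq : (T%:R : rat) != 0 by rewrite pnatr_eq0 -lt0n.
pose F (r j : nat) := e (2%:R * r%:R / T%:R * j%:R) *: iter j g v.
pose p r := T%:R^-1 *: \sum_(j < T) F r j.
have -> : v = \sum_(r < T) p r.
  rewrite -scaler_sumr exchange_big /=.
  under eq_bigr => j _ do rewrite -scaler_suml expipi_sum //.
  case: T T0 Tn {gT AP Tq F p} => // T _ Tn.
  rewrite big_ord_recl /= big1 ?addr0 => [|j _]; last by rewrite scale0r.
  by rewrite scalerA mulVf ?scale1r.
have [P0 PD _] := sP; apply: big_ind => // r _; apply: (AP r) => //.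
  apply: (AZ); apply: big_ind => // j _; apply: (AZ).
  exact: (iter_stable j Ag).
rewrite /twist_space /= /p (linZ lg) (lin_sum lg) scalerA mulrC -scalerA.
congr (_ *: _); rewrite scaler_sumr.
have FS j : g (F r j) = e (- (2%:R * r%:R / T%:R)) *: F r j.+1.
  rewrite /F (linZ lg) scalerA -expipiD; congr (e _ *: _).
  by rewrite -(natr1 j); ring.
under eq_bigr => j _ do rewrite FS.
rewrite -!scaler_sumr; congr (_ *: _).
(* The summands are periodic in j with period T, so that the cyclic shift caused by g leaves their
   sum unchanged. *)
have FT : F r T = F r 0%N.
  rewrite /F gT /= mulr0 divfK // expipi0.
  by rewrite -[r%:R]/((r%:Z)%:~R) expipi_even.
move: (F r) FT T0 => f FT; rewrite -(big_mkord xpredT f).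
rewrite -(big_mkord xpredT (fun j => f j.+1)) => T0.
by apply: (addrI (f 0%N)); rewrite -big_nat_recl // big_nat_recr //= FT addrC.
Qed.

Lemma finite_order_comp (T : Type) (g1 g2 : T -> T) :
  (forall x, g1 (g2 x) = g2 (g1 x)) -> finite_order g1 -> finite_order g2 ->
  finite_order (g1 \o g2).
Proof.
move=> gC [n1 [n1_gt0 h1]] [n2 [n2_gt0 h2]].
exists (n1 * n2)%N; split; first by rewrite muln_gt0 n1_gt0.
have gCn n x : iter n g1 (g2 x) = g2 (iter n g1 x).
  by elim: n => //= n ->; rewrite gC.
have iter_comp n x : iter n (g1 \o g2) x = iter n g1 (iter n g2 x).
  by elim: n => //= n ->; rewrite gCn.
have iter_mul n m (f : T -> T) : iter m f =1 id -> iter (n * m) f =1 id.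
  by move=> fm; elim: n => // n IHn x; rewrite mulSn iterD IHn.
by move=> x; rewrite iter_comp (iter_mul _ _ _ h2) mulnC (iter_mul _ _ _ h1).
Qed.

(** As v is nonzero and g_3^{T_3} = 1, the number (r1/T1 + r2/T2) T3 is an integer; dividing it by
    T3 yields the remainder r3 and the carry j. A zero remainder of a positive number forces j > 0,
    which later puts modes of vectors of weight 0 into C_1. *)
Lemma twist_comp (g1 g2 : V -> V) r1 r2 v : v != 0 ->
  linear g1 -> linear g2 -> finite_order (g1 \o g2) ->
  (r1 < ord_of g1)%N -> (r2 < ord_of g2)%N ->
  twist_space g1 r1 v -> twist_space g2 r2 v ->
  exists r3, [/\ (r3 < ord_of (g1 \o g2))%N, twist_space (g1 \o g2) r3 v &
    exists j : nat, r1%:R / (ord_of g1)%:R + r2%:R / (ord_of g2)%:R =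
      r3%:R / (ord_of (g1 \o g2))%:R + j%:R :> rat
      /\ ((r3 == 0%N) && ((r1 != 0%N) || (r2 != 0%N)) ==> (0 < j)%N)].
Proof.
move=> v0 l1 l2 /ord_ofP [T0 gT _] r1T r2T h1 h2.
set a : rat := r1%:R / _; set b : rat := r2%:R / _.
set T := ord_of (g1 \o g2) in T0 gT *.
have Tq : (T%:R : rat) != 0 by rewrite pnatr_eq0 -lt0n.
have frac r U : (r < U)%N -> 0 <= (r%:R / U%:R : rat) < 1.
  move=> rU; have U0 : (0 < U)%N by case: U rU.
  by rewrite divr_ge0 ?ler0n //= ltr_pdivrMr ?ltr0n // mul1r ltr_nat.
have /andP [a0 a1] : 0 <= a < 1 by exact: frac.
have /andP [b0 b1] : 0 <= b < 1 by exact: frac.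
have h3 : g1 (g2 v) = e (- (2%:R * (a + b))) *: v.
  rewrite h2 (linZ l1) h1 scalerA -expipiD; congr (e _ *: _).
  by rewrite /a /b; ring.
have hi j : iter j (g1 \o g2) v = e (- (2%:R * (a + b)) * j%:R) *: v.
  elim: j => [|j IHj]; first by rewrite mulr0 expipi0 scale1r.
  rewrite /= IHj (linZ l2) (linZ l1) h3 scalerA -expipiD.
  by congr (e _ *: _); rewrite -(natr1 j); ring.
have /expipi_eq1 : e (2%:R * (- (a + b) * T%:R)) = 1.
  apply/eqP; rewrite -subr_eq0; apply/eqP.
  have := hi T; rewrite gT /= => /eqP; rewrite eq_sym -subr_eq0.
  rewrite -[X in _ - X]scale1r -scalerBl scaler_eq0 (negbTE v0) orbF => /eqP <-.
  by congr (e _ - _); ring.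
rewrite mulNr rpredN => /intrP [m Em].
have Eab : a + b = m%:~R / T%:R by rewrite -Em mulfK.
have T0q : (0 : rat) < T%:R by rewrite ltr0n.
have m0 : 0 <= m by rewrite -(ler0z rat) -Em mulr_ge0 ?addr_ge0 // ltW.
have m2 : m < (2 * T)%N%:Z.
  rewrite -(ltr_int rat) -Em -pmulrn natrM ltr_pM2r //; lra.
exists (`|m|%N %% T)%N; split.
- by rewrite ltn_mod.
- rewrite /twist_space /= h3 -/T; congr (_ *: _).
  have -> : a + b = (`|m| %% T)%N%:R / T%:R + (`|m| %/ T)%N%:R.
    rewrite Eab -[in LHS](gez0_abs m0) {1}(divn_eq `|m|%N T) -pmulrn natrD natrM.
    by rewrite mulrDl mulfK // addrC.
  rewrite mulrDr opprD expipiD.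
  have -> : e (- (2%:R * (`|m| %/ T)%N%:R)) = 1.
    by rewrite expipiN -[(_ %/ _)%N%:R]/((_ %/ _)%N%:Z%:~R) expipi_even invr1.
  by rewrite mulr1 mulrA.
exists (`|m| %/ T)%N; split.
  rewrite Eab -[in LHS](gez0_abs m0) {1}(divn_eq `|m|%N T) -pmulrn natrD natrM.
  by rewrite mulrDl mulfK // addrC.
apply/implyP => /andP [/eqP mT r12]; rewrite divn_gt0 //.
have ab0 : 0 < a + b.
  have pos r U : (r < U)%N -> r != 0%N -> (0 : rat) < r%:R / U%:R.
    by move=> rU r0; rewrite divr_gt0 // ltr0n ?lt0n //; case: U rU.
  have [r1n|/(pos _ _ r2T) bpos] := orP r12; last by rewrite ltr_wpDl.
  by rewrite ltr_wpDr // pos.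
have : m != 0 by apply/eqP => m_0; move: ab0; rewrite Eab m_0 mul0r ltxx.
move: mT => /eqP; rewrite -/(dvdn T `|m|%N) => mT mn.
by apply: dvdn_leq => //; rewrite absz_gt0.
Qed.

(** Decompose by weight, then under g1 inside a weight space, then under g2 inside the result. Each
    subspace is stable under the next map, since automorphisms preserve weights and g1, g2
    commute. *)
Lemma twist2_ind (g1 g2 : V -> V) (P : set V) :
  voa_automorphism g1 -> voa_automorphism g2 ->
  finite_order g1 -> finite_order g2 ->
  (forall v, g1 (g2 v) = g2 (g1 v)) -> subspace P ->
  (forall r1 r2 h v, (r1 < ord_of g1)%N -> (r2 < ord_of g2)%N ->
    twist_space g1 r1 v -> twist_space g2 r2 v -> voa_gr h v -> P v) ->
  forall v, P v.
Proof.
move=> a1 a2 f1 f2 gC sP hP; have [l1 _ _ _ _] := a1; have [l2 _ _ _ _] := a2.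
apply: (graded_ind (voa_gr_sum V)) => // h.
apply: (twist_ind l1 f1) => //.
- exact: voa_gr_subspace.
- by move=> v; exact: voa_auto_gr.
move=> r1 v r1T hv v1.
apply: (twist_ind (g := g2) (A := @voa_gr _ V h `&` twist_space g1 r1)) (conj hv v1) => //.
- by apply: subspaceI; [exact: voa_gr_subspace|exact: twist_space_subspace].
- move=> u [hu u1]; split; first exact: voa_auto_gr.
  exact: twist_space_comm.
by move=> r2 u r2T [hu u1] u2; exact: (hP r1 r2 h).
Qed.

End TwistSpaces.
End Twisting.

(** * Twisted modules *)

Section Binomial.
Variable K : numFieldType.

Lemma binom0 (a : K) : binom a 0 = 1.
Proof. by rewrite /binom big_ord0 divr1. Qed.

Lemma binom1 (a : K) : binom a 1 = a.
Proof. by rewrite /binom big_ord1 subr0 divr1. Qed.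

Lemma binom_gt n i : (n < i)%N -> binom (n%:R : K) i = 0.
Proof.
by move=> ni; rewrite /binom (bigD1 (Ordinal ni)) //= subrr !mul0r.
Qed.

End Binomial.

Section TwistedModule.
Variables (R : realType) (V : voa R) (g : V -> V).
Local Notation C := R[i].
Hypotheses (ga : voa_automorphism g) (gf : finite_order g).
Local Notation T := (ord_of g).
Let lg : linear g. Proof. by case: ga. Qed.
Let T0 : (0 < T)%N. Proof. by case: (ord_ofP gf). Qed.

Section Weak.
Variables (W : lmodType C) (Y : V -> rat -> W -> W).
Hypothesis wY : weak_twisted_module g Y.
Let lr := tw_linear_r wY.
Let ll := tw_linear_l wY.

Lemma Lop0E : Lop Y 0 = Y (voa_omega V) 1.
Proof. by []. Qed.

Lemma LopN1E : Lop Y (-1) = Y (voa_omega V) 0.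
Proof. by rewrite /Lop; congr (Y _ _). Qed.

Lemma Lop_linear n : linear (Lop Y n).
Proof. exact: lr. Qed.

(** Since L(-1)v = v_{-2} 1, the derivative property is a case of the Jacobi identity with the
    vacuum as second vector. *)
Lemma tw_Lm1 v n w :
  Y (voa_Y (voa_omega V) 0 v) n w = - ratr n *: Y v (n - 1) w.
Proof.
pose P := [set v : V | forall n w,
  Y (voa_Y (voa_omega V) 0 v) n w = - ratr n *: Y v (n - 1) w].
suff : P v by exact.
have lw := @voa_Y_linear_r _ V (voa_omega V) 0.
apply: (@twist_ind _ _ g setT P lg gf) => // [|r {}v rT _ hv m {}w].
  split=> [m u|v1 v2 h1 h2 m u|a v1 h1 m u].
  - by rewrite (lin0 lw) !(lin0 (ll _ _)) scaler0.
  - by rewrite (linD lw) !(linD (ll _ _)) h1 h2 scalerDr.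
  by rewrite (linZ lw) !(linZ (ll _ _)) h1 !scalerA mulrC.
have [mi|mi] := boolP (m + r%:R / T%:R \is a Num.int); last first.
  rewrite (tw_coset wY _ rT (voa_Lm1_twist ga hv) mi).
  rewrite (tw_coset wY _ rT hv) ?scaler0 //.
  by apply: contra mi => mi; rewrite -[m](subrK 1) addrAC rpredD ?int_num1.
(* As 1_n = 0 for n != -1, both sums on the left vanish at l = -2, n = 0. *)
have := tw_jacobi wY (voa_vac V) w (-2) m 0 rT hv; rewrite mi.
rewrite fsum_nat0 => [|i]; last first.
  rewrite (tw_vacuum wY) ifN ?(lin0 (lr _ _)) ?scaler0 //.
  by apply/eqP; have := ler0n rat i; lra.
rewrite fsum_nat0 => [|i]; last first.
  rewrite (tw_vacuum wY) ifN ?scaler0 //.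
  by apply/eqP; have := ler0n rat i; lra.
rewrite subr0 (fsum_nat (N := 2)) => [|i i2]; last first.
  rewrite voa_creation; last by lia.
  by rewrite ifN ?(lin0 (ll _ _)) ?scaler0 //; lia.
rewrite big_ord_recl big_ord1 /= binom0 binom1 voa_Y2_vac voa_creation // eqxx.
by rewrite scale1r !addr0 => /esym/eqP; rewrite addr_eq0 scaleNr => /eqP.
Qed.

(** The commutator of omega_1 with v_n is the Jacobi identity at l = 0, m = 1; two terms survive on
    the right, from omega_0 v = L(-1) v and omega_1 v = h v. *)
Lemma tw_L0 h v n w : voa_gr h v ->
  Lop Y 0 (Y v n w) = Y v n (Lop Y 0 w) + (h%:~R - ratr n - 1) *: Y v n w.
Proof.
move=> hv; rewrite Lop0E.
have := tw_jacobi wY v w 0 1 n T0 (voa_omega_twist ga).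
rewrite mul0r addr0 int_num1.
have b0 i : (1 <= i)%N -> binom (0%:~R : C) i = 0 by exact: (@binom_gt _ 0).
have b1 i : (2 <= i)%N -> binom (ratr 1 : C) i = 0.
  by rewrite rmorph1; exact: (@binom_gt _ 1).
rewrite (fsum_nat (N := 1)) => [|i i0]; last by rewrite (b0 i i0) mulr0 scale0r.
rewrite (fsum_nat (N := 1)) => [|i i0]; last by rewrite (b0 i i0) !mulr0 scale0r.
rewrite (fsum_nat (N := 2)) => [|i i2]; last by rewrite (b1 i i2) scale0r.
rewrite !big_ord1 [X in _ = X]big_ord_recl !big_ord1 /= !binom0 binom1.
rewrite !mulr1 !addr0 ?subr0 !scale1r.
rewrite rmorph1 scale1r (voa_L0 hv) (linZ (ll _ _)) tw_Lm1.
move/eqP; rewrite subr_eq => /eqP ->.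
rewrite [LHS]addrC; congr (_ + _); rewrite [1 + n]addrC.
rewrite -scalerDl !addrK rmorphD rmorph1; congr (_ *: _); ring.
Qed.

Lemma tw_mode_shift h v n l w : voa_gr h v ->
  shift (Lop Y 0) (l + (h%:~R - ratr n - 1)) (Y v n w)
  = Y v n (shift (Lop Y 0) l w).
Proof.
move=> hv; rewrite /shift (tw_L0 _ _ hv) (linB (lr _ _)) (linZ (lr _ _)).
move: (h%:~R - _ - 1) => c.
by rewrite scalerDl opprD addrACA subrr addr0.
Qed.

Lemma tw_mode_gen h v n l w : voa_gr h v -> gen_eigenspace (Lop Y 0) l w ->
  gen_eigenspace (Lop Y 0) (l + (h%:~R - ratr n - 1)) (Y v n w).
Proof.
move=> hv [k hk]; exists k; rewrite -/(shift _ _).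
rewrite (iter_intertwine (D := shift (Lop Y 0) l)) ?hk ?(lin0 (lr _ _)) //.
by move=> u; exact: tw_mode_shift.
Qed.

Lemma tw_trunc_gen u w : exists N : rat, forall n, N <= n -> Y u n w = 0.
Proof.
pose P := [set u : V | exists N : rat, forall n, N <= n -> Y u n w = 0].
suff : P u by [].
apply: (@twist_ind _ _ g setT P lg gf) => // [|r {}u rT _ hu]; last first.
  exact: (tw_trunc wY w rT hu).
split=> [|v1 v2 [N1 h1] [N2 h2]|a v1 [N1 h1]].
- by exists 0 => n _; rewrite (lin0 (ll _ _)).
- exists (Num.max N1 N2) => n; rewrite ge_max => /andP [n1 n2].
  by rewrite (linD (ll _ _)) h1 // h2 // addr0.
by exists N1 => n n1; rewrite (linZ (ll _ _)) h1 // scaler0.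
Qed.

Lemma tw_trunc_nat u w (n : rat) :
  exists N : nat, forall i, (N <= i)%N -> Y u (n + i%:R) w = 0.
Proof.
have [N hN] := tw_trunc_gen u w.
exists (Num.truncn `|N - n|).+1 => i hi; apply: hN.
have := truncnS_gt `|N - n|; rewrite -(ler_nat rat) in hi => h.
have := ler_norm (N - n); move: h hi; lra.
Qed.

End Weak.

Section C1.
Variables (W : lmodType C) (Y : V -> rat -> W -> W).
Hypothesis gY : generalized_twisted_module g Y.
Let wY : weak_twisted_module g Y := gtm_weak gY.
Let lr := tw_linear_r wY.
Let ll := tw_linear_l wY.
Let lL : linear (Lop Y 0). Proof. exact: Lop_linear. Qed.

(** The homogeneous generators of weight [l], with both families of [C1_space] merged. The mode
    v_{-1-r/T} raises weights by h + r/T, whence the weight required of [w]. *)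
Definition C1_gen (l : C) : set W :=
  [set x | exists (r : nat) v (h : int) w,
    [/\ (r < T)%N, twist_space g r v, voa_gr h v, 0 <= h &
     (r == 0%N) ==> (0 < h)]
    /\ gen_eigenspace (Lop Y 0) (l - h%:~R - (r%:R / T%:R)) w
    /\ x = Y v (-1 - r%:R / T%:R) w].

Lemma C1_gen_eig l : C1_gen l `<=` gen_eigenspace (Lop Y 0) l.
Proof.
move=> x [r [v [h [w [[rT hv hh h0 rh] [hw ->]]]]]].
have := tw_mode_gen (wY) (-1 - r%:R / T%:R) hh hw.
rewrite rmorphB rmorphN rmorph1 fmorph_div !rmorph_nat.
by have -> : forall a b : C, l - a - b + (a - (-1 - b) - 1) = l by move=> a b; ring.
Qed.

Lemma C1_sub_gen : C1_space g Y `<=` linspan [set x | exists l, C1_gen l x].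
Proof.
apply: linspan_sub; first exact: linspan_is_subspace.
have key r v h w : (r < T)%N -> twist_space g r v -> voa_gr h v -> 0 <= h ->
    (r == 0%N) ==> (0 < h) ->
    linspan [set x | exists l, C1_gen l x] (Y v (-1 - r%:R / T%:R) w).
  move=> rT hv hh h0 rh.
  apply: (graded_ind (gtm_sum gY)
    (P := [set w | linspan [set x | exists l, C1_gen l x] (Y v (-1 - r%:R / T%:R) w)])).
    exact: subspace_preim (lr _ _) (linspan_is_subspace _).
  move=> l u hu; apply: linspan_subset; exists (l + h%:~R + r%:R / T%:R).
  exists r, v, h, u; split => //; split => //.
  by have -> : forall a b : C, l + a + b - a - b = l by move=> a b; ring.
move=> x [[v [w [n [hv hn n0 ->]]]]|[r [v [w [n [/andP [r1 rT] hv hn n0 ->]]]]]].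
  have -> : (-1 : rat) = -1 - 0%N%:R / T%:R by rewrite mul0r subr0.
  by apply: (key _ _ n) => //; rewrite ltW.
by apply: (key _ _ n) => //; rewrite eqn0Ngt r1.
Qed.

Lemma C1_graded l w : gen_eigenspace (Lop Y 0) l w -> C1_space g Y w ->
  linspan (C1_gen l) w.
Proof.
move=> hw /C1_sub_gen; apply: (graded_span (gtm_sum gY)) => //.
exact: C1_gen_eig.
Qed.

Lemma C1_mem r v h w : (r < T)%N -> twist_space g r v -> voa_gr h v -> 0 <= h ->
  (r == 0%N) ==> (0 < h) -> C1_space g Y (Y v (-1 - r%:R / T%:R) w).
Proof.
move=> rT hv hh h0 rh; apply: linspan_subset.
have [r0|r0] := eqVneq r 0%N.
  left; exists v, w, h; move: rh; rewrite r0 /= mul0r subr0 => rh; split=> //.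
  by rewrite -r0.
by right; exists r, v, w, h; rewrite lt0n r0.
Qed.

(** By [tw_Lm1], v_{m-1} is a multiple of (L(-1)v)_m, with factor 1/(1 + j + r/T) for the modes at
    hand. Induction on j thus replaces v by L(-1) v, whose weight h + 1 is positive; so j > 0
    suffices when r = h = 0. *)
Lemma C1_mem_ge r v h w (j : nat) : (r < T)%N -> twist_space g r v ->
  voa_gr h v -> 0 <= h -> (r == 0%N) ==> (0 < h) || (0 < j)%N ->
  C1_space g Y (Y v (-1 - j%:R - r%:R / T%:R) w).
Proof.
move=> rT; elim: j v h => [|j IHj] v h hv hh h0 rh.
  by rewrite subr0; apply: (C1_mem (h := h)) => //; move: rh; rewrite orbF.
have [_ _ CZ] := @linspan_is_subspace _ W (
    ([set x | exists v w (n : int),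
        [/\ twist_space g 0 v, voa_gr n v, 0 < n & x = Y v (-1) w]]
     `|`
     [set x | exists (r : nat) v w (n : int),
        [/\ (1 <= r < ord_of g)%N, twist_space g r v, voa_gr n v, 0 <= n
          & x = Y v (-1 - r%:R / (ord_of g)%:R) w]])).
have := IHj _ (h + 1) (voa_Lm1_twist ga hv) (voa_Lm1_gr hh).
rewrite (tw_Lm1 wY) => /(_ _ _)/(CZ (- ratr (-1 - j%:R - r%:R / T%:R))^-1).
have r0 : 0 <= (r%:R / T%:R : rat) by rewrite divr_ge0 ?ler0n.
rewrite scalerA mulVf ?scale1r => [H|]; last first.
  rewrite oppr_eq0 fmorph_eq0; apply/eqP.
  by have := ler0n rat j; move: r0; lra.
have -> : -1 - j.+1%:R - r%:R / T%:R = -1 - j%:R - r%:R / T%:R - 1 :> rat.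
  by rewrite -(natr1 j); ring.
by apply: H; [lia|apply/implyP => _; lia].
Qed.

Lemma C1_subspace : subspace (C1_space g Y).
Proof. exact: linspan_is_subspace. Qed.

Lemma C1_shift mu w : C1_space g Y w -> C1_space g Y (shift (Lop Y 0) mu w).
Proof.
have lS := shift_linear mu lL.
move=> /C1_sub_gen; apply: (linspan_sub (P := [set w | _])).
  exact: subspace_preim lS C1_subspace.
move=> x [l [r [v [h [u [[rT hv hh h0 rh] [_ ->]]]]]]] /=.
rewrite /shift (tw_L0 wY _ _ hh) -addrA -scalerBl.
have [_ CD CZ] := C1_subspace; apply: CD; last apply: CZ.
  exact: (C1_mem (h := h)).
exact: (C1_mem (h := h)).
Qed.

End C1.
End TwistedModule.

(** * Intertwining operators *)

Lemma uniform_bound (p : nat) (Q : nat -> nat -> Prop) :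
  (forall i, (i < p)%N -> exists K, forall k, (K <= k)%N -> Q i k) ->
  exists K, forall i k, (i < p)%N -> (K <= k)%N -> Q i k.
Proof.
elim: p => [|p IHp] h; first by exists 0%N.
have [i ip|K hK] := IHp; first exact: (h i (ltnW ip)).
have [K' hK'] := h p (ltnSn p).
exists (maxn K K') => i k; rewrite ltnS leq_eqVlt geq_max => /orP [/eqP ->|ip] /andP [h1 h2].
  exact: hK'.
exact: hK.
Qed.

Section Operators.
Variables (R : realType) (V : voa R) (g1 g2 : V -> V).
Local Notation C := R[i].
Hypotheses (a1 : voa_automorphism g1) (a2 : voa_automorphism g2).
Hypotheses (f1 : finite_order g1) (f2 : finite_order g2).
Hypothesis gC : forall v, g1 (g2 v) = g2 (g1 v).
Local Notation g3 := (g1 \o g2).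
Local Notation T1 := (ord_of g1).
Local Notation T2 := (ord_of g2).

Lemma voa_auto_comp : voa_automorphism g3.
Proof.
have [l1 b1 Y1 v1 w1] := a1; have [l2 b2 Y2 v2 w2] := a2.
split=> [a u v|||/=|/=].
- by rewrite /= l2 l1.
- exact: bij_comp.
- by move=> u n v /=; rewrite Y2 Y1.
- by rewrite v2 v1.
by rewrite w2 w1.
Qed.
Let a3 := voa_auto_comp.
Let f3 := finite_order_comp gC f1 f2.
Let T10 : (0 < T1)%N. Proof. by case: (ord_ofP f1). Qed.
Let T20 : (0 < T2)%N. Proof. by case: (ord_ofP f2). Qed.
Let lg1 : linear g1. Proof. by case: a1. Qed.
Let lg2 : linear g2. Proof. by case: a2. Qed.

(** In terms of g_3 the mode is -1 - (j + i) - r3/T3, where j is the carry of [twist_comp], and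
    [C1_mem_ge] applies. If h = 0 and r3 = 0, then r1 or r2 is nonzero and the carry is positive. *)
Lemma C1_mem_comp (W : lmodType C) (Y : V -> rat -> W -> W) r1 r2 v h w (i : nat) :
  generalized_twisted_module g3 Y -> (r1 < T1)%N -> (r2 < T2)%N ->
  twist_space g1 r1 v -> twist_space g2 r2 v -> voa_gr h v -> 0 <= h ->
  ((r1 == 0%N) && (r2 == 0%N) ==> (0 < h)) ->
  C1_space g3 Y (Y v (-1 - r1%:R / T1%:R - r2%:R / T2%:R - i%:R) w).
Proof.
move=> gY r1T r2T v1 v2 hh h0 rh.
have [->|v0] := eqVneq v 0.
  rewrite (lin0 (tw_linear_l (gtm_weak gY) _ _)).
  by have [] := C1_subspace g3 Y.
have [r3 [r3T v3 [j [Ej hj]]]] := twist_comp v0 lg1 lg2 f3 r1T r2T v1 v2.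
have -> : -1 - r1%:R / T1%:R - r2%:R / T2%:R - i%:R =
    -1 - (j + i)%N%:R - r3%:R / (ord_of g3)%:R :> rat.
  rewrite natrD; move: Ej.
  by move: (r1%:R / _) (r2%:R / _) (r3%:R / _) (j%:R) (i%:R) => *; lra.
apply: (C1_mem_ge a3 f3 gY _ r3T v3 hh h0).
apply/implyP => r30; move: hj rh; rewrite r30 /=.
by case: (r1 == _); case: (r2 == _) => //= hj rh; rewrite ?rh ?addn_gt0 ?hj ?orbT.
Qed.

Section Op.
Variables (W1 W2 U : lmodType C) (Y1 : V -> rat -> W1 -> W1).
Variables (Y2 : V -> rat -> W2 -> W2) (Y : V -> rat -> U -> U).
Variable Z : W1 -> C -> nat -> W2 -> U.
Hypothesis gY : generalized_twisted_module g3 Y.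
Hypothesis wY1 : weak_twisted_module g1 Y1.
Hypothesis wY2 : weak_twisted_module g2 Y2.
Hypothesis hZ : intertwining_operator g1 g2 Y1 Y2 Y Z.
Let wY : weak_twisted_module g3 Y := gtm_weak gY.
Let zl := io_linear_l hZ.
Let zr := io_linear_r hZ.
Let yr := tw_linear_r wY.

(** The Jacobi identity for omega at l = 0, m = 1. The term with omega_0 = L(-1) acting on w1
    becomes a derivative by [io_Lm1], and differentiating log x produces the coefficient of index k
    + 1. *)
Lemma io_L0 w1 n k w2 : Lop Y 0 (Z w1 n k w2) =
  Z (Lop Y1 0 w1) n k w2 + Z w1 n k (Lop Y2 0 w2)
  - (n + 1) *: Z w1 n k w2 + k.+1%:R *: Z w1 n k.+1 w2.
Proof.
have := io_jacobi hZ w1 w2 0 1 n k T10 T20 (voa_omega_twist a1) (voa_omega_twist a2).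
rewrite !mul0r !addr0 int_num0 int_num1.
have b0 i : (1 <= i)%N -> binom (ratr 0 : C) i = 0.
  by rewrite rmorph0; exact: (@binom_gt _ 0).
have b1 i : (2 <= i)%N -> binom (ratr 1 : C) i = 0.
  by rewrite rmorph1; exact: (@binom_gt _ 1).
rewrite (fsum_nat (N := 1)) => [|i i0]; last by rewrite (b0 i i0) mulr0 scale0r.
rewrite (fsum_nat (N := 1)) => [|i i0]; last by rewrite (b0 i i0) !mulr0 scale0r.
rewrite (fsum_nat (N := 2)) => [|i i2]; last by rewrite (b1 i i2) scale0r.
rewrite !big_ord1 [X in _ = X]big_ord_recl !big_ord1 /= !binom0 binom1.
rewrite subrr expipi0 rmorph0 rmorph1 !mulr1 !addr0 !subr0 !scale1r.
rewrite !Lop0E -!LopN1E (io_Lm1 hZ).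
move/eqP; rewrite subr_eq => /eqP ->.
have -> : forall c : C, 1 + n - c = n - c + 1 by move=> c; ring.
rewrite !subrK [1 + n]addrC rmorph0 addr0 scaleNr.
by rewrite [LHS](ACl (3*4*1*2)).
Qed.

(** At the mode n = l1 + l2 - 1 - mu the scalar terms of [io_L0] cancel, since l1 + l2 - (n + 1) =
    mu. What remains has the shape of hypothesis [DF]. *)
Lemma io_shift l1 l2 mu w1 k w2 :
  shift (Lop Y 0) mu (Z w1 (l1 + l2 - 1 - mu) k w2) =
  Z (shift (Lop Y1 0) l1 w1) (l1 + l2 - 1 - mu) k w2
  + Z w1 (l1 + l2 - 1 - mu) k (shift (Lop Y2 0) l2 w2)
  + k.+1%:R *: Z w1 (l1 + l2 - 1 - mu) k.+1 w2.
Proof.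
rewrite /shift io_L0 (linB (zl _ _ _)) (linZ (zl _ _ _)) (linB (zr _ _ _)) (linZ (zr _ _ _)).
have -> : l1 + l2 - 1 - mu + 1 = l1 + l2 - mu by ring.
set n := l1 + l2 - 1 - mu.
set A := Z _ n k w2; set B := Z w1 n k (Lop _ _ _); set D := Z _ n _ w2.
set E := Z w1 n k w2; rewrite scalerBl scalerDl.
by rewrite opprB opprD !addrA [LHS](ACl (1*4*2*5*6*3*7)) /= addrK.
Qed.

(** [derivation_nilpotent] with [P] equal to {0}. A common bound on the powers of log x exists
    because only finitely many pairs of iterates of w1 and w2 are nonzero. *)
Lemma io_gen l1 l2 mu w1 k w2 : gen_eigenspace (Lop Y1 0) l1 w1 ->
  gen_eigenspace (Lop Y2 0) l2 w2 ->
  gen_eigenspace (Lop Y 0) mu (Z w1 (l1 + l2 - 1 - mu) k w2).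
Proof.
move=> [p hp] [q hq].
set n := l1 + l2 - 1 - mu.
pose N1 := shift (Lop Y1 0) l1; pose N2 := shift (Lop Y2 0) l2.
rewrite -[iter p _ _]/(iter p N1 w1) in hp.
rewrite -[iter q _ _]/(iter q N2 w2) in hq.
have [K hK] : exists K, forall i k, (i < p)%N -> (K <= k)%N ->
    forall j, Z (iter i N1 w1) n k (iter j N2 w2) = 0.
  apply: uniform_bound => i _.
  have [K hK] : exists K, forall j k, (j < q)%N -> (K <= k)%N ->
      Z (iter i N1 w1) n k (iter j N2 w2) = 0.
    apply: uniform_bound => j _; exact: (io_log hZ).
  exists K => k' hk' j; have [jq|qj] := ltnP j q; first exact: hK.
  rewrite (iter_lin0_ge _ qj hq) ?(lin0 (zr _ _ _)) //.
  exact: shift_linear (Lop_linear wY2 _).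
exists (p + q + K)%N; rewrite -/(shift _ _).
apply: (@derivation_nilpotent _ _ _ _ N1 N2 (shift (Lop Y 0) mu)
  (fun k w1 w2 => Z w1 n k w2) _ _ _ _ [set 0] K p q K) => //.
- by move=> k' u; rewrite (lin0 (zl _ _ _)).
- by move=> k' u; rewrite (lin0 (zr _ _ _)).
- exact: shift_linear (Lop_linear wY _).
- by move=> k' u1 u2; exact: io_shift.
- exact: subspace0.
- by move=> u -> /=; rewrite (lin0 (shift_linear _ (Lop_linear wY _))).
- move=> i j k' hk'; have [ip|pi] := ltnP i p; first exact: hK.
  rewrite (iter_lin0_ge _ pi hp) ?(lin0 (zl _ _ _)) //.
  exact: shift_linear (Lop_linear wY1 _).
exact: leq_addl.
Qed.

Section Reduction.
Variables (r1 r2 : nat) (v : V) (h : int).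
Hypotheses (r1T : (r1 < T1)%N) (r2T : (r2 < T2)%N).
Hypotheses (v1 : twist_space g1 r1 v) (v2 : twist_space g2 r2 v).
Hypotheses (hh : voa_gr h v) (h0 : 0 <= h).
Local Notation a := (r1%:R / T1%:R : rat).
Local Notation b := (r2%:R / T2%:R : rat).

(** The Jacobi identity at l = -1 - a, m = -b. On the side of [U] only the modes v_{-1-a-b-i} occur,
    which lie in C_1 by [C1_mem_comp]; the other terms form the displayed sum. The third index is n
    + b so that the leading coefficient has mode n. *)
Lemma io_C1_left w1 n k w2 (N : nat) : ((r1 == 0%N) ==> (0 < h)) ->
  (forall i, (N <= i)%N -> Y1 v (- a + i%:R) w1 = 0) ->
  (forall i, (N <= i)%N -> Y2 v (- b + i%:R) w2 = 0) ->
  C1_space g3 Y (1 *: Z (Y1 v (-1 - a) w1) n k w2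
    + \sum_(i < N) binom (ratr (- b)) i.+1 *: Z (Y1 v (- a + i%:R) w1) (n - i.+1%:R) k w2
    + \sum_(i < N) (expipi R (-1 - a - i%:R) * binom (ratr (-1 - a)) i) *:
        Z w1 (n + ratr b + ratr (-1 - a) - i%:R) k (Y2 v (- b + i%:R) w2)).
Proof.
move=> rh t1 t2.
have := io_jacobi hZ w1 w2 (-1 - a) (- b) (n + ratr b) k r1T r2T v1 v2.
rewrite subrK addNr int_num0 -[-1 \is a Num.int]/true.
have [N' hN'] := io_trunc hZ w1 w2 (n + ratr b).
rewrite (fsum_nat (N := N')) => [|i hi]; last first.
  by rewrite hN' // (lin0 (yr _ _)) scaler0.
rewrite (fsum_nat (N := N)) => [|i hi]; last first.
  by rewrite t2 // (lin0 (zr _ _ _)) scaler0.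
have e1 i : -1 - a + i.+1%:R = - a + i%:R :> rat by rewrite -(natr1 i); ring.
rewrite (fsum_nat (N := N.+1)) => [|[//|i] hi]; last first.
  by rewrite e1 t1 // (lin0 (zl _ _ _)) scaler0.
rewrite big_ord_recl binom0 addr0.
have e2 : ratr (- b) + (n + ratr b) = n by rewrite rmorphN addrC addrK.
rewrite e2 subr0.
under [X in _ = _ + X]eq_bigr => i _ do rewrite lift0 e1.
move/eqP; rewrite subr_eq => /eqP <-.
apply: subspace_sum; first exact: C1_subspace.
move=> i _ _; have [_ _ CZ] := C1_subspace g3 Y; apply: CZ.
have -> : - b + (-1 - a) - i%:R = -1 - a - b - i%:R by ring.
apply: (C1_mem_comp (h := h)) => //.
by apply/implyP => /andP [r0 _]; move: rh; rewrite r0.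
Qed.

(** The mirror case l = -a, m = -1 - b. The leading scalar e^{-pi i a} comes from expanding (-x2 +
    x1)^{-a}. *)
Lemma io_C1_right w1 n k w2 (N : nat) : ((r2 == 0%N) ==> (0 < h)) ->
  (forall i, (N <= i)%N -> Y1 v (- a + i%:R) w1 = 0) ->
  (forall i, (N <= i)%N -> Y2 v (- b + i%:R) w2 = 0) ->
  C1_space g3 Y (expipi R (- a) *: Z w1 n k (Y2 v (-1 - b) w2)
    + \sum_(i < N) (expipi R (- a - i.+1%:R) * binom (ratr (- a)) i.+1) *:
        Z w1 (n - i.+1%:R) k (Y2 v (- b + i%:R) w2)
    + \sum_(i < N) binom (ratr (-1 - b)) i *:
        Z (Y1 v (- a + i%:R) w1) (n + ratr a + ratr (-1 - b) - i%:R) k w2).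
Proof.
move=> rh t1 t2.
have := io_jacobi hZ w1 w2 (- a) (-1 - b) (n + ratr a) k r1T r2T v1 v2.
rewrite subrK addNr int_num0 -[-1 \is a Num.int]/true.
have [N' hN'] := io_trunc hZ w1 w2 (n + ratr a).
rewrite (fsum_nat (N := N')) => [|i hi]; last first.
  by rewrite hN' // (lin0 (yr _ _)) scaler0.
have e1 i : -1 - b + i.+1%:R = - b + i%:R :> rat by rewrite -(natr1 i); ring.
rewrite (fsum_nat (N := N.+1)) => [|[//|i] hi]; last first.
  by rewrite e1 t2 // (lin0 (zr _ _ _)) scaler0.
rewrite (fsum_nat (N := N)) => [|i hi]; last first.
  by rewrite t1 // (lin0 (zl _ _ _)) scaler0.
rewrite big_ord_recl binom0 addr0 mulr1 subr0.
have e2 : n + ratr a + ratr (- a) = n by rewrite rmorphN addrK.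
rewrite e2 subr0.
under [X in _ - (_ + X)]eq_bigr => i _ do rewrite lift0 e1.
have e3 (i : nat) : ratr (-1 - b) + (n + ratr a) - i%:R =
    n + ratr a + ratr (-1 - b) - i%:R :> C by ring.
under [X in _ = X]eq_bigr => i _ do rewrite e3.
rewrite [X in C1_space _ _ X]addrC.
move/eqP; rewrite subr_eq => /eqP <-.
apply: subspace_sum; first exact: C1_subspace.
move=> i _ _; have [_ _ CZ] := C1_subspace g3 Y; apply: CZ.
have -> : -1 - b + - a - i%:R = -1 - a - b - i%:R by ring.
apply: (C1_mem_comp (h := h)) => //.
by apply/implyP => /andP [_ r0]; move: rh; rewrite r0.
Qed.

End Reduction.
End Op.
End Operators.

(** * Reduction modulo C_1 *)

Section Generators.
Variables (R : realType) (V : voa R) (g g' : V -> V).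
Local Notation C := R[i].
Hypotheses (ga : voa_automorphism g) (ga' : voa_automorphism g').
Hypotheses (gf : finite_order g) (gf' : finite_order g').
Hypothesis gC : forall v, g' (g v) = g (g' v).
Local Notation T := (ord_of g).
Local Notation T' := (ord_of g').

(** Here v is a simultaneous eigenvector of both automorphisms, as the Jacobi identity of an
    intertwining operator requires. *)
Definition C1_gen2 (W : lmodType C) (Y : V -> rat -> W -> W) (l : C) : set W :=
  [set x | exists (r r' : nat) v (h : int) w,
    [/\ (r < T)%N, (r' < T')%N, twist_space g r v, twist_space g' r' v & voa_gr h v]
    /\ [/\ 0 <= h, (r == 0%N) ==> (0 < h),
      gen_eigenspace (Lop Y 0) (l - h%:~R - (r%:R / T%:R)) w
      & x = Y v (-1 - r%:R / T%:R) w]].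

Lemma C1_gen_gen2 (W : lmodType C) (Y : V -> rat -> W -> W) l :
  weak_twisted_module g Y -> C1_gen g Y l `<=` linspan (C1_gen2 Y l).
Proof.
move=> wY x [r [v [h [w [[rT vr hv h0 rh] [hw ->]]]]]].
have [lg _ _ _ _] := ga; have [lg' _ _ _ _] := ga'.
apply: (twist_ind (g := g') (A := @voa_gr _ V h `&` twist_space g r)
  (P := [set v | linspan (C1_gen2 Y l) (Y v (-1 - r%:R / T%:R) w)])) (conj hv vr) => //.
- by apply: subspaceI; [exact: voa_gr_subspace|exact: twist_space_subspace].
- move=> u [hu u1]; split; first exact: voa_auto_gr.
  by apply: twist_space_comm => // x'; rewrite gC.
- exact: subspace_preim (tw_linear_l wY _ _) (linspan_is_subspace _).
move=> r' u r'T [hu u1] u2; apply: linspan_subset.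
by exists r, r', u, h, w.
Qed.

(** Finitely many representatives of W/C_1(W) are replaced by their homogeneous components. As the
    generators of C_1(W) are homogeneous too, [graded_span] expresses a vector of weight l by
    generators of weight l alone. *)
Lemma hom_generators (W : gtwmod g) : C1_cofinite W ->
  exists A : seq (C * W),
    (forall p, p \in A -> gen_eigenspace (Lop (@gtw_Y _ _ _ W) 0) p.1 p.2) /\
    forall l w, gen_eigenspace (Lop (@gtw_Y _ _ _ W) 0) l w ->
      linspan (C1_gen2 (@gtw_Y _ _ _ W) l `|` [set x | (l, x) \in A]) w.
Proof.
have gY := gtw_axioms W; set Y := @gtw_Y _ _ _ W in gY *.
have wY := gtm_weak gY; have dW := gtm_sum gY; set L := Lop Y 0 in dW *.
move=> [s hs].
have [A [hA sA]] : exists A : seq (C * W),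
    (forall p, p \in A -> gen_eigenspace L p.1 p.2) /\
    [set` s] `<=` linspan [set x | exists l, (l, x) \in A].
  elim: s {hs} => [|x s [A [hA sA]]]; first by exists [::]; split.
  have [_ gen _] := dW; have [t [f [hf Ex]]] := gen x.
  exists ([seq (i, f i) | i <- t] ++ A); split=> [p|y].
    by rewrite mem_cat => /orP [/mapP [i _ ->]|/hA //]; exact: hf.
  rewrite /= inE => /orP [/eqP ->|ys]; last first.
    have /sA : [set` s] y by [].
    apply: linspan_mono => z [l lz]; exists l; by rewrite mem_cat lz orbT.
  rewrite Ex; apply: subspace_sum; first exact: linspan_is_subspace.
  move=> i it _; apply: linspan_subset; exists i.
  by rewrite mem_cat map_f.
exists A; split=> // l w hw.
pose G l := C1_gen g Y l `|` [set x | (l, x) \in A].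
have hG i : G i `<=` gen_eigenspace L i.
  move=> x [|/hA //]; exact: (C1_gen_eig ga gf gY).
suff : linspan (G l) w.
  apply: linspan_sub; first exact: linspan_is_subspace.
  move=> x [/(C1_gen_gen2 wY)|hx]; last by apply: linspan_subset; right.
  by apply: linspan_mono => y; left.
apply: (graded_span dW hG hw).
have [a [Ca Sa]] := hs w; rewrite -[w](subrK a).
have [_ LD _] := linspan_is_subspace [set x | exists i, G i x].
apply: LD.
  move: Sa => /(linspan_mono sA)/linspan_idem; apply: linspan_mono.
  by move=> x [i xi]; exists i; right.
move: Ca => /(C1_sub_gen gf gY); apply: linspan_mono.
by move=> x [i xi]; exists i; left.
Qed.

End Generators.

(** * Congruences modulo C_1 that hold for all modules at once *)

Section Modules.
Variables (R : realType) (V : voa R) (g1 g2 : V -> V).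
Local Notation C := R[i].
Hypotheses (a1 : voa_automorphism g1) (a2 : voa_automorphism g2).
Hypotheses (f1 : finite_order g1) (f2 : finite_order g2).
Hypothesis gC : forall v, g1 (g2 v) = g2 (g1 v).
Local Notation g3 := (g1 \o g2).
Local Notation T1 := (ord_of g1).
Local Notation T2 := (ord_of g2).
Variables (W1 : gtwmod g1) (W2 : gtwmod g2).
Local Notation Y1 := (@gtw_Y _ _ _ W1).
Local Notation Y2 := (@gtw_Y _ _ _ W2).
Local Notation hom1 := (gen_eigenspace (Lop Y1 0)).
Local Notation hom2 := (gen_eigenspace (Lop Y2 0)).
Local Notation intertwining M Z :=
  (intertwining_operator g1 g2 Y1 Y2 (@gtw_Y _ _ _ M) Z).
Local Notation C1 M := (C1_space g3 (@gtw_Y _ _ _ M)).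

Let wY1 := gtm_weak (gtw_axioms W1).
Let wY2 := gtm_weak (gtw_axioms W2).
Let a3 := voa_auto_comp a1 a2.
Let f3 := finite_order_comp gC f1 f2.
Local Notation T3 := (ord_of g3).
Local Notation hom M := (gen_eigenspace (Lop (@gtw_Y _ _ _ M) 0)).
Let T10 : (0 < T1)%N. Proof. by case: (ord_ofP f1). Qed.
Let T20 : (0 < T2)%N. Proof. by case: (ord_ofP f2). Qed.

(** A vector defined simultaneously for every target module and every operator, so that the
    coefficients of a relation between families cannot depend on either. *)
Definition family := forall M : gtwmod g3, (W1 -> C -> nat -> W2 -> M) -> C -> nat -> M.

(* If w1 and w2 have weights l1 and l2, this is the coefficient of (log x)^k in
   Z(w1,x)w2 that has weight mu. *)
Definition coef (l1 : C) (w1 : W1) (l2 : C) (w2 : W2) : family :=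
  fun M Z mu k => Z w1 (l1 + l2 - 1 - mu) k w2.

Definition congr_C1 (f f' : family) := forall (M : gtwmod g3) Z,
  intertwining M Z -> forall mu k, C1 M (f M Z mu k - f' M Z mu k).

Section Reducible.
Variables (N : nat) (B : 'I_N -> (C * W1) * (C * W2)).

Definition basis_comb (c : 'rV[C]_N) : family :=
  fun M Z mu k =>
    \sum_i c 0 i *: coef (B i).1.1 (B i).1.2 (B i).2.1 (B i).2.2 Z mu k.

(** The row [c] is chosen before the module, the operator, mu and k; this order of quantifiers is
    the source of all uniform bounds. *)
Definition reducible (f : family) := exists c, congr_C1 f (basis_comb c).

Lemma reducible_congr f f' : congr_C1 f f' -> reducible f' -> reducible f.
Proof.
move=> ff' [c hc]; exists c => M Z hZ mu k.
have [_ CD _] := C1_subspace g3 (@gtw_Y _ _ _ M).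
by have := CD _ _ (ff' M Z hZ mu k) (hc M Z hZ mu k); rewrite addrA subrK.
Qed.

Lemma congr_C1_eq f f' : (forall (M : gtwmod g3) (Z : W1 -> C -> nat -> W2 -> M),
  intertwining M Z -> forall mu k, f M Z mu k = f' M Z mu k) -> congr_C1 f f'.
Proof.
move=> ff' M Z hZ mu k; rewrite ff' // subrr.
by have [] := C1_subspace g3 (@gtw_Y _ _ _ M).
Qed.

Lemma basis_comb_linear (M : gtwmod g3) (Z : W1 -> C -> nat -> W2 -> M) mu k :
  linear (fun c => basis_comb c Z mu k).
Proof.
move=> a c c'; rewrite /basis_comb scaler_sumr -big_split /=.
by apply: eq_bigr => i _; rewrite !mxE scalerDl scalerA.
Qed.

Lemma reducible_lin a f f' : reducible f -> reducible f' ->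
  reducible (fun M Z mu k => a *: f M Z mu k + f' M Z mu k).
Proof.
move=> [c hc] [c' hc']; exists (a *: c + c') => M Z hZ mu k.
rewrite (basis_comb_linear Z mu k a c c').
have [_ CD CZ] := C1_subspace g3 (@gtw_Y _ _ _ M).
have := CD _ _ (CZ a _ (hc M Z hZ mu k)) (hc' M Z hZ mu k).
by rewrite scalerBr addrACA opprD.
Qed.

Lemma reducible0 : reducible (fun M Z mu k => 0).
Proof.
exists 0 => M Z hZ mu k; rewrite (lin0 (basis_comb_linear Z mu k)) subr0.
by have [] := C1_subspace g3 (@gtw_Y _ _ _ M).
Qed.

Lemma reducibleD f f' : reducible f -> reducible f' ->
  reducible (fun M Z mu k => f M Z mu k + f' M Z mu k).
Proof.
move=> rf rf'; apply: reducible_congr (reducible_lin 1 rf rf').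
by apply: congr_C1_eq => M Z _ mu k; rewrite scale1r.
Qed.

Lemma reducibleZ a f : reducible f -> reducible (fun M Z mu k => a *: f M Z mu k).
Proof.
move=> rf; apply: reducible_congr (reducible_lin a rf reducible0).
by apply: congr_C1_eq => M Z _ mu k; rewrite addr0.
Qed.

Lemma reducible_sum n (a : 'I_n -> C) (f : 'I_n -> family) :
  (forall i, reducible (f i)) ->
  reducible (fun M Z mu k => \sum_i a i *: f i M Z mu k).
Proof.
move=> rf; elim: n a f rf => [|n IHn] a f rf.
  apply: reducible_congr reducible0.
  by apply: congr_C1_eq => M Z _ mu k; rewrite big_ord0.
have := reducible_lin (a ord0) (rf ord0)
  (IHn (fun i => a (lift ord0 i)) (fun i => f (lift ord0 i)) (fun i => rf _)).
apply: reducible_congr; apply: congr_C1_eq => M Z _ mu k.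
by rewrite big_ord_recl.
Qed.

Lemma reducible_subspace1 l1 l2 w2 :
  subspace [set w1 | reducible (coef l1 w1 l2 w2)].
Proof.
split=> [|u v ru rv|a u ru] /=.
- apply: reducible_congr reducible0; apply: congr_C1_eq => M Z hZ mu k.
  by rewrite /coef (lin0 (io_linear_l hZ _ _ _)).
- apply: reducible_congr (reducibleD ru rv); apply: congr_C1_eq => M Z hZ mu k.
  by rewrite /coef (linD (io_linear_l hZ _ _ _)).
apply: reducible_congr (reducibleZ a ru); apply: congr_C1_eq => M Z hZ mu k.
by rewrite /coef (linZ (io_linear_l hZ _ _ _)).
Qed.

Lemma reducible_subspace2 l1 w1 l2 :
  subspace [set w2 | reducible (coef l1 w1 l2 w2)].
Proof.
split=> [|u v ru rv|a u ru] /=.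
- apply: reducible_congr reducible0; apply: congr_C1_eq => M Z hZ mu k.
  by rewrite /coef (lin0 (io_linear_r hZ _ _ _)).
- apply: reducible_congr (reducibleD ru rv); apply: congr_C1_eq => M Z hZ mu k.
  by rewrite /coef (linD (io_linear_r hZ _ _ _)).
apply: reducible_congr (reducibleZ a ru); apply: congr_C1_eq => M Z hZ mu k.
by rewrite /coef (linZ (io_linear_r hZ _ _ _)).
Qed.

Lemma basis_comb_delta (M : gtwmod g3) (Z : W1 -> C -> nat -> W2 -> M) mu k i :
  basis_comb (delta_mx 0 i) Z mu k = coef (B i).1.1 (B i).1.2 (B i).2.1 (B i).2.2 Z mu k.
Proof.
rewrite /basis_comb (bigD1 i) //= mxE !eqxx scale1r big1 ?addr0 // => j ji.
by rewrite mxE (negbTE ji) andbF scale0r.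
Qed.

Lemma reducible_basis i :
  reducible (coef (B i).1.1 (B i).1.2 (B i).2.1 (B i).2.2).
Proof.
by exists (delta_mx 0 i); apply: congr_C1_eq => M Z hZ mu k; rewrite basis_comb_delta.
Qed.

Lemma ratr_frac r T : ratr (r%:R / T%:R : rat) = r%:R / T%:R :> C.
Proof. by rewrite fmorph_div !rmorph_nat. Qed.

Lemma ratr_frac1 r T : ratr (-1 - r%:R / T%:R : rat) = -1 - r%:R / T%:R :> C.
Proof. by rewrite rmorphB rmorphN rmorph1 fmorph_div !rmorph_nat. Qed.

Lemma ratr_fracD r T i :
  ratr (- (r%:R / T%:R) + i%:R : rat) = - (r%:R / T%:R) + i%:R :> C.
Proof. by rewrite rmorphD rmorphN fmorph_div !rmorph_nat. Qed.

Lemma trunc_bound u w1 w2 (n1 n2 : rat) : exists N' : nat, forall i, (N' <= i)%N ->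
  Y1 u (n1 + i%:R) w1 = 0 /\ Y2 u (n2 + i%:R) w2 = 0.
Proof.
have [N1 h1] := tw_trunc_nat a1 f1 wY1 u w1 n1.
have [N2 h2] := tw_trunc_nat a2 f2 wY2 u w2 n2.
exists (maxn N1 N2) => i; rewrite geq_max => /andP [? ?].
by rewrite h1 ?h2.
Qed.

(** With a = r1/T1 and b = r2/T2, the pairs in the hypotheses have total weight smaller than l1 + l2
    by i + 1 and by i + 1 + a - b respectively; the latter is positive because b < 1. *)
Lemma reducible_left l1 l2 r1 r2 v h w1 w2 :
  (r1 < T1)%N -> (r2 < T2)%N -> twist_space g1 r1 v -> twist_space g2 r2 v ->
  voa_gr h v -> 0 <= h -> (r1 == 0%N) ==> (0 < h) ->
  (forall i : nat, reducible (coef (l1 - i.+1%:R) (Y1 v (- (r1%:R / T1%:R) + i%:R) w1) l2 w2)) ->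
  (forall i : nat, reducible (coef (l1 - h%:~R - r1%:R / T1%:R) w1
    (l2 + h%:~R + r2%:R / T2%:R - i.+1%:R) (Y2 v (- (r2%:R / T2%:R) + i%:R) w2))) ->
  reducible (coef l1 (Y1 v (-1 - r1%:R / T1%:R) w1) l2 w2).
Proof.
move=> r1T r2T v1 v2 hh h0 rh red1 red2.
have [N' hN'] := trunc_bound v w1 w2 (- (r1%:R / T1%:R)) (- (r2%:R / T2%:R)).
have := reducibleZ (-1) (reducibleD
  (reducible_sum (fun i : 'I_N' => binom (ratr (- (r2%:R / T2%:R))) i.+1) (fun i => red1 i))
  (reducible_sum (fun i : 'I_N' => expipi R (-1 - r1%:R / T1%:R - i%:R) *
     binom (ratr (-1 - r1%:R / T1%:R)) i) (fun i => red2 i))).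
apply: reducible_congr => M Z hZ mu k.
have := io_C1_left a1 a2 f1 f2 gC (gtw_axioms M) hZ r1T r2T v1 v2 hh h0
  (l1 + l2 - 1 - mu) k rh (fun i hi => (hN' i hi).1) (fun i hi => (hN' i hi).2).
rewrite scale1r -addrA scaleN1r opprK /coef.
congr (C1_space _ _ (_ + (_ + _))); apply: eq_bigr => i _; congr (_ *: _).
  by have -> : l1 - i.+1%:R + l2 - 1 - mu = l1 + l2 - 1 - mu - i.+1%:R by ring.
congr (Z _ _ _ _); rewrite ratr_frac1 ratr_frac -(natr1 i).
by move: (r1%:R / _) (r2%:R / _) => a b; ring.
Qed.

Lemma reducible_right l1 l2 r1 r2 v h w1 w2 :
  (r1 < T1)%N -> (r2 < T2)%N -> twist_space g1 r1 v -> twist_space g2 r2 v ->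
  voa_gr h v -> 0 <= h -> (r2 == 0%N) ==> (0 < h) ->
  (forall i : nat, reducible (coef l1 w1 (l2 - i.+1%:R) (Y2 v (- (r2%:R / T2%:R) + i%:R) w2))) ->
  (forall i : nat, reducible (coef (l1 + h%:~R + r1%:R / T1%:R - i.+1%:R)
    (Y1 v (- (r1%:R / T1%:R) + i%:R) w1) (l2 - h%:~R - r2%:R / T2%:R) w2)) ->
  reducible (coef l1 w1 l2 (Y2 v (-1 - r2%:R / T2%:R) w2)).
Proof.
move=> r1T r2T v1 v2 hh h0 rh red1 red2.
have [N' hN'] := trunc_bound v w1 w2 (- (r1%:R / T1%:R)) (- (r2%:R / T2%:R)).
set x := expipi R (- (r1%:R / T1%:R)).
have x0 : x != 0.
  apply/eqP => x0; have := expipiD R (- (r1%:R / T1%:R)) (r1%:R / T1%:R).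
  by rewrite addNr expipi0 -/x x0 mul0r => /eqP; rewrite oner_eq0.
have := reducibleZ (- x^-1) (reducibleD
  (reducible_sum (fun i : 'I_N' => expipi R (- (r1%:R / T1%:R) - i.+1%:R) *
     binom (ratr (- (r1%:R / T1%:R))) i.+1) (fun i => red1 i))
  (reducible_sum (fun i : 'I_N' => binom (ratr (-1 - r2%:R / T2%:R)) i)
     (fun i => red2 i))).
apply: reducible_congr => M Z hZ mu k.
have := io_C1_right a1 a2 f1 f2 gC (gtw_axioms M) hZ r1T r2T v1 v2 hh h0
  (l1 + l2 - 1 - mu) k rh (fun i hi => (hN' i hi).1) (fun i hi => (hN' i hi).2).
have [_ _ CZ] := C1_subspace g3 (@gtw_Y _ _ _ M).
move=> /(CZ x^-1); rewrite -addrA scalerDr scalerA mulVf // scale1r.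
rewrite scaleNr opprK /coef.
congr (C1_space _ _ (_ + _ *: (_ + _))); apply: eq_bigr => i _; congr (_ *: _).
  by have -> : l1 + (l2 - i.+1%:R) - 1 - mu = l1 + l2 - 1 - mu - i.+1%:R by ring.
congr (Z _ _ _ _); rewrite ratr_frac1 ratr_frac -(natr1 i).
by move: (r1%:R / _) (r2%:R / _) => a b; ring.
Qed.

Variables (A1 : seq (C * W1)) (A2 : seq (C * W2)).
Hypothesis A1_gen : forall l w, hom1 l w ->
  linspan (C1_gen2 g1 g2 Y1 l `|` [set x | (l, x) \in A1]) w.
Hypothesis A2_gen : forall l w, hom2 l w ->
  linspan (C1_gen2 g2 g1 Y2 l `|` [set x | (l, x) \in A2]) w.
Hypothesis A1_hom : forall p, p \in A1 -> hom1 p.1 p.2.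
Hypothesis BA : forall p q, p \in A1 -> q \in A2 -> exists i, B i = (p, q).

Lemma hom_reducible l1 w1 l2 w2 : hom1 l1 w1 -> hom2 l2 w2 ->
  reducible (coef l1 w1 l2 w2).
Proof.
have [m1 hm1] := gtm_low (gtw_axioms W1) l1.
have [m2 hm2] := gtm_low (gtw_axioms W2) l2.
have T1n : (T1%:R : C) != 0 by rewrite pnatr_eq0 -lt0n.
have T2n : (T2%:R : C) != 0 by rewrite pnatr_eq0 -lt0n.
(* Induction on T1 T2 times the total weight, relative to l1 + l2. *)
suff main d : forall (n1 n2 : int) k1 k2 u1 u2,
    k1 = l1 + n1%:~R / T1%:R -> k2 = l2 + n2%:~R / T2%:R ->
    n1 * T2%:Z + n2 * T1%:Z <= m1 * T2%:Z + m2 * T1%:Z + d%:Z ->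
    hom1 k1 u1 -> hom2 k2 u2 -> reducible (coef k1 u1 k2 u2).
  move=> h1 h2; apply: (main `|(m1 * T2%:Z + m2 * T1%:Z)%R|%N 0 0 l1 l2 w1 w2) => //.
  - by rewrite mul0r addr0.
  - by rewrite mul0r addr0.
  by lia.
(* For d = 0 the bound forces n1 <= m1 or n2 <= m2, so one of the two vectors lies in a weight space
   that vanishes by [gtm_low]. *)
elim: d => [|d IHd] n1 n2 k1 k2 u1 u2 E1 E2 le12 h1 h2.
  have [n1m|n1m] := lerP n1 m1.
    have -> : u1 = 0 by apply: (hm1 n1) => //; rewrite -E1.
    by have [] := reducible_subspace1 k1 k2 u2.
  have -> : u2 = 0.
    apply: (hm2 n2) => /=; last by rewrite -E2.
    rewrite -(ler_pM2r (x := T1%:Z)) ?ltz_nat //.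
    have : m1 * T2%:Z <= n1 * T2%:Z by rewrite ler_pM2r ?ltz_nat // ltW.
    by lia.
  by have [] := reducible_subspace2 k1 u1 k2.
have red n1' n2' k1' k2' u1' u2' : k1' = l1 + n1'%:~R / T1%:R ->
    k2' = l2 + n2'%:~R / T2%:R ->
    n1' * T2%:Z + n2' * T1%:Z < n1 * T2%:Z + n2 * T1%:Z ->
    hom1 k1' u1' -> hom2 k2' u2' -> reducible (coef k1' u1' k2' u2').
  move=> e1 e2 lt12; apply: (IHd n1' n2') => //; lia.
(* First u1 is expanded: a generator of C_1 leads to lower total weight, an element of [A1] is kept.
   Only then is u2 expanded, and a pair from [A1] and [A2] is one of the [B i]. *)
apply: (linspan_sub (reducible_subspace1 k1 k2 u2) _ (A1_gen h1)).
move=> x [[r1 [r2 [v [h [w [[r1T r2T v1 v2 hh] [h0 rh hw ->]]]]]]]|xA1] /=.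
  apply: (reducible_left r1T r2T v1 v2 hh h0 rh) => i.
    apply: (red (n1 - i.+1%:Z * T1%:Z) n2) => //.
    - by rewrite E1 -(natr1 i); field.
    - have : 0 < T1%:Z * T2%:Z by rewrite mulr_gt0.
      nia.
    have := tw_mode_gen a1 f1 wY1 (- (r1%:R / T1%:R) + i%:R) hh hw.
    rewrite ratr_fracD -(natr1 i).
    by have -> : k1 - h%:~R - r1%:R / T1%:R + (h%:~R - (- (r1%:R / T1%:R) + i%:R) - 1)
      = k1 - (i%:R + 1) by move: (r1%:R / _) => a; ring.
  apply: (red (n1 - h * T1%:Z - r1%:Z) (n2 + h * T2%:Z + r2%:Z - i.+1%:Z * T2%:Z)) => //.
  - by rewrite E1; field.
  - by rewrite E2 -(natr1 i); field.
  - have : r2%:Z * T1%:Z < T2%:Z * T1%:Z by rewrite ltr_pM2r.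
    have : 0 <= i%:Z * T1%:Z * T2%:Z by [].
    have : 0 <= r1%:Z * T2%:Z by [].
    nia.
  have := tw_mode_gen a2 f2 wY2 (- (r2%:R / T2%:R) + i%:R) hh h2.
  rewrite ratr_fracD -(natr1 i).
  by have -> : k2 + (h%:~R - (- (r2%:R / T2%:R) + i%:R) - 1)
    = k2 + h%:~R + r2%:R / T2%:R - (i%:R + 1) by move: (r2%:R / _) => a; ring.
have hx : hom1 k1 x by exact: (A1_hom xA1).
apply: (linspan_sub (reducible_subspace2 k1 x k2) _ (A2_gen h2)).
move=> y [[r2 [r1 [v [h [w [[r2T r1T v2 v1 hh] [h0 rh hw ->]]]]]]]|yA2] /=; last first.
  by have [i Bi] := BA xA1 yA2; have := reducible_basis i; rewrite Bi.
apply: (reducible_right r1T r2T v1 v2 hh h0 rh) => i.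
  apply: (red n1 (n2 - i.+1%:Z * T2%:Z)) => //.
  - by rewrite E2 -(natr1 i); field.
  - have : 0 < T1%:Z * T2%:Z by rewrite mulr_gt0.
    nia.
  have := tw_mode_gen a2 f2 wY2 (- (r2%:R / T2%:R) + i%:R) hh hw.
  rewrite ratr_fracD -(natr1 i).
  by have -> : k2 - h%:~R - r2%:R / T2%:R + (h%:~R - (- (r2%:R / T2%:R) + i%:R) - 1)
    = k2 - (i%:R + 1) by move: (r2%:R / _) => a; ring.
apply: (red (n1 + h * T1%:Z + r1%:Z - i.+1%:Z * T1%:Z) (n2 - h * T2%:Z - r2%:Z)) => //.
- by rewrite E1 -(natr1 i); field.
- by rewrite E2; field.
- have : r1%:Z * T2%:Z < T1%:Z * T2%:Z by rewrite ltr_pM2r.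
  have : 0 <= i%:Z * T1%:Z * T2%:Z by [].
  have : 0 <= r2%:Z * T1%:Z by [].
  nia.
have := tw_mode_gen a1 f1 wY1 (- (r1%:R / T1%:R) + i%:R) hh hx.
rewrite ratr_fracD -(natr1 i).
by have -> : k1 + (h%:~R - (- (r1%:R / T1%:R) + i%:R) - 1)
  = k1 + h%:~R + r1%:R / T1%:R - (i%:R + 1) by move: (r1%:R / _) => a; ring.
Qed.

End Reducible.

Section Spanning.
Variables (U : lmodType C) (Z : W1 -> C -> nat -> W2 -> U).
Hypothesis zl : forall n k w2, linear (fun w1 => Z w1 n k w2).
Hypothesis zr : forall w1 n k, linear (Z w1 n k).

Lemma coef_ind (P : set U) : subspace P ->
  (forall l1 w1 l2 w2 n k, hom1 l1 w1 -> hom2 l2 w2 -> P (Z w1 n k w2)) ->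
  forall w1 n k w2, P (Z w1 n k w2).
Proof.
move=> sP hP w1 n k w2; move: w1.
apply: (graded_ind (gtm_sum (gtw_axioms W1))); first exact: subspace_preim (zl n k w2) sP.
move=> l1 w1 h1 /=; move: w2.
apply: (graded_ind (gtm_sum (gtw_axioms W2))); first exact: subspace_preim (zr w1 n k) sP.
by move=> l2 w2 h2; exact: (hP l1 w1 l2 w2).
Qed.

End Spanning.

(** * The differential system on the generating pairs and uniform bounds *)

Section Basis.
Variables (N : nat) (B : 'I_N.+1 -> (C * W1) * (C * W2)).
Hypothesis B1 : forall i, hom1 (B i).1.1 (B i).1.2.
Hypothesis B2 : forall i, hom2 (B i).2.1 (B i).2.2.
Hypothesis redB : forall l1 w1 l2 w2, hom1 l1 w1 -> hom2 l2 w2 ->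
  reducible B (coef l1 w1 l2 w2).
Local Notation bc := (basis_comb B).

Lemma connection_matrix : exists A : 'M[C]_N.+1, forall (M : gtwmod g3) Z,
  intertwining M Z -> forall mu k i,
  C1 M (k.+1%:R *: bc (delta_mx 0 i) Z mu k.+1 - bc (row i (A - mu%:M)) Z mu k).
Proof.
have redL i : exists c, congr_C1 (coef ((B i).1.1 + 1) (Lop Y1 (-1) (B i).1.2)
    (B i).2.1 (B i).2.2) (bc c).
  apply: redB; last exact: B2.
  have := tw_mode_gen a1 f1 (gtm_weak (gtw_axioms W1)) 0 (voa_omega_gr V) (B1 i).
  by rewrite LopN1E rmorph0 subr0 -[2%:~R]/(1 + 1) addrK.
have [c hc] := choice redL.
(* Row i holds the reduction of (L(-1)w1, w2) for the pair [B i]. The derivative contributes the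
   further diagonal term l1 + l2 - mu, of which l1 + l2 goes into A and mu is split off. *)
exists (\matrix_(i, j) (c i 0 j + ((B i).1.1 + (B i).2.1) *+ (i == j))).
move=> M Z hZ mu k i; set A := matrix_of_fun _ _.
have -> : row i (A - mu%:M) = ((B i).1.1 + (B i).2.1 - mu) *: delta_mx 0 i + c i.
  apply/rowP => j; rewrite !mxE eqxx eq_sym /=; case: (j == i) => /=.
    by rewrite !mulr1n mulr1; ring.
  by rewrite !mulr0n mulr0 addr0 subr0 add0r.
rewrite (basis_comb_linear B Z mu k _ _ (c i)).
have [_ _ CZ] := C1_subspace g3 (@gtw_Y _ _ _ M).
have := hc i M Z hZ mu k; rewrite !basis_comb_delta /coef (io_Lm1 hZ).
have -> : (B i).1.1 + 1 + (B i).2.1 - 1 - mu = (B i).1.1 + (B i).2.1 - mu by ring.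
have -> : (B i).1.1 + (B i).2.1 - mu - 1 = (B i).1.1 + (B i).2.1 - 1 - mu by ring.
move: (Z _ _ k _) (Z _ _ k.+1 _) (bc _ _ _ _) ((B i).1.1 + _ - mu) => E F G al.
by rewrite scaleNr [- _ + _]addrC -addrA -opprD.
Qed.

(** The connection matrix turns one power of log x into one factor D = A - mu, up to a nonzero
    scalar and modulo C_1. Hence [chi] is the characteristic polynomial of A, and e is the exponent
    of [matrix_fitting], fixed before the module and the operator. *)
Lemma log_vanishing : exists chi : {poly C}, chi != 0 /\ forall mu, exists e : nat,
  (~~ root chi mu -> e = 0%N) /\ forall (M : gtwmod g3) Z, intertwining M Z ->
  forall k l1 w1 l2 w2, (e <= k)%N -> hom1 l1 w1 -> hom2 l2 w2 ->
  C1 M (coef l1 w1 l2 w2 Z mu k).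
Proof.
have [A hA] := connection_matrix.
exists (char_poly A); split; first exact: monic_neq0 (char_poly_monic A).
move=> mu; have [e [X [hX he]]] := matrix_fitting A mu; exists e; split=> //.
move=> M Z hZ k l1 w1 l2 w2 ek h1 h2; set D := A - mu%:M in hX.
have CS := C1_subspace g3 (@gtw_Y _ _ _ M); have [C0 CD CZ] := CS.
have step c j : C1 M (bc c Z mu j.+1) <-> C1 M (bc (c *m D) Z mu j).
  have hd : C1 M (j.+1%:R *: bc c Z mu j.+1 - bc (c *m D) Z mu j).
    have Ec : c = \sum_i c 0 i *: delta_mx 0 i by exact: row_sum_delta.
    rewrite {1}Ec mulmx_sum_row !(lin_sum (basis_comb_linear B Z mu _)).
    rewrite scaler_sumr -sumrB; apply: subspace_sum => // i _ _.
    rewrite !(linZ (basis_comb_linear B Z mu _)) scalerA mulrC -scalerA -scalerBr.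
    by apply: CZ; exact: hA.
  have j0 : (j.+1%:R : C) != 0 by rewrite pnatr_eq0.
  split=> h.
    rewrite -[bc _ _ _ _](subKr (j.+1%:R *: bc c Z mu j.+1)).
    by apply: subspaceB => //; exact: CZ.
  rewrite -[bc _ _ _ _]scale1r -(mulVf j0) -scalerA; apply: CZ.
  by rewrite -[_ *: _](subrK (bc (c *m D) Z mu j)); exact: CD.
have steps s c j : C1 M (bc c Z mu (j + s)%N) <-> C1 M (bc (c *m D ^+ s) Z mu j).
  elim: s c j => [|s IHs] c j; first by rewrite addn0 expr0 mulmx1.
  by rewrite addnS step IHs exprS -mulmxA.
have hXs s : D ^+ e = X ^+ s * D ^+ (e + s).
  elim: s => [|s IHs]; first by rewrite expr0 addn0 mul1r.
  have hs : D ^+ (e + s) = X * D ^+ (e + s).+1.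
    by rewrite exprD {1}hX -mulrA -exprD addSn.
  by rewrite {1}IHs hs mulrA -exprSr addnS.
have [K hK] : exists K, forall i j, (i < N.+1)%N -> (K <= j)%N ->
    coef (B (inord i)).1.1 (B (inord i)).1.2 (B (inord i)).2.1 (B (inord i)).2.2 Z mu j = 0.
  by apply: uniform_bound => i _; exact: (io_log hZ).
have bc0 c j : (K <= j)%N -> bc c Z mu j = 0.
  move=> Kj; rewrite /basis_comb big1 // => i _.
  by have := hK i j (ltn_ord i) Kj; rewrite inord_val => ->; rewrite scaler0.
have [c hc] := redB h1 h2.
rewrite -[coef _ _ _ _ _ _ _](subrK (bc c Z mu k)); apply: CD; first exact: hc.
(* Of the k powers of log x, e are traded for D^e = X^K D^{e+K}, and D^{e+K} is traded back for e +
   K powers. The resulting index is at least K, where the coefficients vanish; K may depend on the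
   operator, e does not. *)
rewrite -(subnK ek) steps (hXs K) -mulmxE mulmxA -steps bc0 //.
by rewrite addnA leq_addl.
Qed.

Variable chi : {poly C}.
Hypothesis chi0 : chi != 0.
Hypothesis hchi : forall mu, exists e : nat,
  (~~ root chi mu -> e = 0%N) /\ forall (M : gtwmod g3) Z, intertwining M Z ->
  forall k l1 w1 l2 w2, (e <= k)%N -> hom1 l1 w1 -> hom2 l2 w2 ->
  C1 M (coef l1 w1 l2 w2 Z mu k).

(** Coefficients of homogeneous pairs are homogeneous and span M, so a vector of weight mu is a
    combination of those of weight mu. *)
Lemma surj_hom_ind (M : gtwmod g3) Z (P : set M) mu u :
  intertwining M Z -> surjective_op Z -> subspace P -> hom M mu u ->
  (forall l1 w1 l2 w2 k, hom1 l1 w1 -> hom2 l2 w2 -> P (coef l1 w1 l2 w2 Z mu k)) ->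
  P u.
Proof.
move=> hZ sZ sP hu hP; pose G mu := [set x | exists l1 w1 l2 w2 k,
  [/\ hom1 l1 w1, hom2 l2 w2 & x = coef l1 w1 l2 w2 Z mu k]].
suff : linspan (G mu) u.
  apply: linspan_sub => // x [l1 [w1 [l2 [w2 [k [h1 h2 ->]]]]]]; exact: hP.
apply: (graded_span (gtm_sum (gtw_axioms M))) (hu) _.
  move=> i x [l1 [w1 [l2 [w2 [k [h1 h2 ->]]]]]].
  exact: (io_gen a1 a2 f1 f2 (gtw_axioms M) wY1 wY2 hZ i k h1 h2).
suff : linspan (coefficients Z) `<=` linspan [set x | exists i, G i x].
  by apply; rewrite sZ.
apply: linspan_sub; first exact: linspan_is_subspace.
move=> x [w1 [n [k [w2 ->]]]].
apply: (coef_ind (io_linear_l hZ) (io_linear_r hZ)); first exact: linspan_is_subspace.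
move=> {}l1 {}w1 {}l2 {}w2 {}n {}k h1 h2; apply: linspan_subset.
exists (l1 + l2 - 1 - n), l1, w1, l2, w2, k; split=> //.
by rewrite /coef; congr (Z _ _ _ _); ring.
Qed.

Lemma T3n : (T3%:R : C) != 0.
Proof. by rewrite pnatr_eq0 -lt0n; case: (ord_ofP f3). Qed.

(** The mode raises weights by h + r/T3, a positive multiple of 1/T3 because h > 0 when r = 0. This
    strict increase drives the inductions on the weight. *)
Lemma C1_gen_nat (M : gtwmod g3) mu x : C1_gen g3 (@gtw_Y _ _ _ M) mu x ->
  exists (j : nat) v n w, hom M (mu - j.+1%:R / T3%:R) w
  /\ x = gtw_Y v n w /\ forall l u, shift (Lop (@gtw_Y _ _ _ M) 0) (l + j.+1%:R / T3%:R) (gtw_Y v n u) =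
     gtw_Y v n (shift (Lop (@gtw_Y _ _ _ M) 0) l u).
Proof.
move=> [r [v [h [w [[rT vr hh h0 rh] [hw ->]]]]]].
have Tgt : (0 < T3)%N by case: (ord_ofP f3).
have [j Ej] : exists j : nat, h%:~R + r%:R / T3%:R = j.+1%:R / T3%:R :> C.
  exists (`|h| * T3 + r).-1; rewrite prednK.
    by rewrite natrD natrM mulrDl mulfK ?T3n // -{1}(gez0_abs h0).
  move: rh; case: (posnP r) => [-> /= rh|r0 _]; last by rewrite addn_gt0 r0 orbT.
  by rewrite addn0 muln_gt0 Tgt andbT absz_gt0 gt_eqF.
exists j, v, (-1 - r%:R / T3%:R), w; split; first by rewrite -Ej opprD addrA.
split=> // l u; rewrite -Ej.
have := tw_mode_shift a3 f3 (gtm_weak (gtw_axioms M)) (-1 - r%:R / T3%:R) l u hh.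
rewrite ratr_frac1.
by have -> : forall y : C, l + (h%:~R - (-1 - y) - 1) = l + (h%:~R + y) by move=> y; ring.
Qed.

(** Where [chi] has no root, the exponent e is 0 and the whole weight space lies in C_1(M). Its
    generators come from strictly lower weights, and the descent ends at the lower bound of M; here
    [d] measures the distance to that bound. *)
Lemma weights_zero (M : gtwmod g3) Z mu u : intertwining M Z -> surjective_op Z ->
  (forall j : nat, ~~ root chi (mu - j%:R / T3%:R)) -> hom M mu u -> u = 0.
Proof.
move=> hZ sZ nr hu; have [m hm] := gtm_low (gtw_axioms M) mu.
suff main d : forall (j : nat) u, (`|m| <= j + d)%N ->
    hom M (mu - j%:R / T3%:R) u -> u = 0.
  by apply: (main `|m|%N 0%N) => //; rewrite mul0r subr0.
elim: d => [|d IHd] j {hu}u hj hu.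
  apply: (hm (- j%:Z)); first by lia.
  by rewrite mulrNz mulNr.
have Cu : C1 M u.
  apply: (surj_hom_ind hZ sZ (C1_subspace _ _) hu) => l1 w1 l2 w2 k h1 h2.
  have [e [he hC]] := hchi (mu - j%:R / T3%:R).
  by apply: hC => //; rewrite he.
have := C1_graded a3 f3 (gtw_axioms M) hu Cu.
apply: (linspan_sub (P := [set 0])); first exact: subspace0.
move=> x /C1_gen_nat [i [v [n [w [hw [-> _]]]]]] /=.
rewrite (IHd (j + i.+1)%N w) ?(lin0 (tw_linear_r (gtm_weak (gtw_axioms M)) _ _)) //; first by lia.
by rewrite natrD mulrDl opprD addrA.
Qed.

(** [chi] has finitely many roots, and each of them equals mu - j/T3 for at most one j. *)
Lemma root_bound mu : exists d : nat, forall j : nat, (d <= j)%N ->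
  ~~ root chi (mu - j%:R / T3%:R).
Proof.
have [s Es] := closed_field_poly_normal chi.
suff [d hd] : exists d : nat, forall j : nat, (d <= j)%N -> mu - j%:R / T3%:R \notin s.
  exists d => j dj; rewrite Es rootZ ?lead_coef_eq0 // root_prod_XsubC; exact: hd.
elim: s {Es} => [|z s [d hd]]; first by exists 0%N.
have [[j0 Ej0]|no] := pselect (exists j0 : nat, mu - j0%:R / T3%:R = z); last first.
  exists d => j dj; rewrite inE negb_or hd // andbT.
  by apply/eqP => Ez; apply: no; exists j.
exists (maxn d j0.+1) => j; rewrite geq_max => /andP [dj j0j].
rewrite inE negb_or hd // andbT -Ej0; apply/eqP => /addrI/oppr_inj.
have T3i : (T3%:R : C)^-1 != 0 by rewrite invr_eq0 T3n.
by move=> /(mulIf T3i)/eqP; rewrite eqr_nat => /eqP jj; rewrite jj ltnn in j0j.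
Qed.

Lemma nilpotency_bound mu : exists K : nat, forall (M : gtwmod g3) Z u,
  intertwining M Z -> surjective_op Z -> hom M mu u ->
  iter K (shift (Lop (@gtw_Y _ _ _ M) 0) mu) u = 0.
Proof.
have [d hd] := root_bound mu.
(* The claim is strengthened to all the weights mu - j/T3 and proved by induction on d: replacing mu
   by mu - 1/T3 lowers d by one, and for d = 0 all these weight spaces vanish. *)
suff main : forall mu, (forall j : nat, (d <= j)%N -> ~~ root chi (mu - j%:R / T3%:R)) ->
    exists K : nat, forall (j : nat) (M : gtwmod g3) Z u,
    intertwining M Z -> surjective_op Z -> hom M (mu - j%:R / T3%:R) u ->
    iter K (shift (Lop (@gtw_Y _ _ _ M) 0) (mu - j%:R / T3%:R)) u = 0.
  have [K hK] := main mu hd; exists K => M Z u hZ sZ hu.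
  by have := hK 0%N M Z u hZ sZ; rewrite mul0r subr0; apply.
elim: d {mu hd} => [|d IHd] mu hd.
  exists 0%N => j M Z u hZ sZ hu /=; apply: (weights_zero hZ sZ _ hu) => i.
  by rewrite -addrA -opprD -mulrDl -natrD; exact: hd.
have subS j : mu - j.+1%:R / T3%:R = mu - 1 / T3%:R - j%:R / T3%:R.
  by rewrite -(natr1 j) mulrDl opprD addrA addrAC.
have [K hK] : exists K : nat, forall (j : nat) (M : gtwmod g3) Z u,
    intertwining M Z -> surjective_op Z -> hom M (mu - j.+1%:R / T3%:R) u ->
    iter K (shift (Lop (@gtw_Y _ _ _ M) 0) (mu - j.+1%:R / T3%:R)) u = 0.
  have [j dj|K hK] := IHd (mu - 1 / T3%:R); first by rewrite -subS hd.
  by exists K => j M Z u hZ sZ; rewrite subS; exact: (hK j M Z u hZ sZ).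
have [e [_ he]] := hchi mu.
have [p hp] : exists p, forall i q, (i < N.+1)%N -> (p <= q)%N ->
    iter q (shift (Lop Y1 0) (B (inord i)).1.1) (B (inord i)).1.2 = 0.
  apply: uniform_bound => i _; have [q hq] := B1 (inord i); exists q => k qk.
  exact: (iter_lin0_ge (shift_linear _ (Lop_linear wY1 _)) qk hq).
have [q hq] : exists q, forall i k, (i < N.+1)%N -> (q <= k)%N ->
    iter k (shift (Lop Y2 0) (B (inord i)).2.1) (B (inord i)).2.2 = 0.
  apply: uniform_bound => i _; have [q hq] := B2 (inord i); exists q => k qk.
  exact: (iter_lin0_ge (shift_linear _ (Lop_linear wY2 _)) qk hq).
(* At weight mu, the first p + q + e applications of L(0) - mu lead into C_1(M). The generators
   found there come from vectors of lower weight, for which K further applications suffice. *)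
exists (K + (p + q + e))%N => -[|j] M Z u hZ sZ; last first.
  move=> hu; apply: (iter_lin0_ge (shift_linear _ (Lop_linear (gtm_weak (gtw_axioms M)) _)) (leq_addr _ _)).
  exact: hK hZ sZ hu.
rewrite mul0r subr0 => hu; set D := shift _ mu.
have lL := Lop_linear (gtm_weak (gtw_axioms M)) 0.
have lD : linear D := shift_linear mu lL.
have CS := C1_subspace g3 (@gtw_Y _ _ _ M); have [C0 CD CZ] := CS.
have CDst x : C1 M x -> C1 M (D x) by exact: (C1_shift a3 f3 (gtw_axioms M)).
have CK : C1 M (iter (p + q + e) D u).
  have sP := subspace_preim (iter_linear (p + q + e) lD) CS.
  apply: (surj_hom_ind hZ sZ sP hu) => l1 w1 l2 w2 k h1 h2 /=.
  have [c hc] := redB h1 h2.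
  rewrite -[coef _ _ _ _ _ _ _](subrK (bc c Z mu k)) (linD (iter_linear _ lD)).
  apply: CD; first exact: (iter_stable _ CDst (hc M Z hZ mu k)).
  rewrite (lin_sum (iter_linear _ lD)); apply: subspace_sum => // i _ _.
  rewrite (linZ (iter_linear _ lD)); apply: CZ.
  have hpi := hp i p (ltn_ord i) (leqnn p); have hqi := hq i q (ltn_ord i) (leqnn q).
  rewrite inord_val in hpi hqi.
  apply: (@derivation_nilpotent _ _ _ _ (shift (Lop Y1 0) (B i).1.1)
    (shift (Lop Y2 0) (B i).2.1) D
    (fun k w1 w2 => coef (B i).1.1 w1 (B i).2.1 w2 Z mu k) _ _ _ _ (C1 M) e p q e) => //.
  - by move=> k' w; rewrite /coef (lin0 (io_linear_l hZ _ _ _)).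
  - by move=> k' w; rewrite /coef (lin0 (io_linear_r hZ _ _ _)).
  - by move=> k' u1 u2; exact: (io_shift a1 a2 f1 f2 hZ).
  - move=> s t k' ek'; apply: he => //; apply: iter_stable => // x.
      exact: gen_eigenspace_shift (Lop_linear wY1 _).
    exact: gen_eigenspace_shift (Lop_linear wY2 _).
  exact: leq_addl.
have hKu : hom M mu (iter (p + q + e) D u).
  by apply: iter_stable hu => x; exact: gen_eigenspace_shift.
rewrite iterD.
have := C1_graded a3 f3 (gtw_axioms M) hKu CK.
apply: (linspan_sub (P := [set x | iter K D x = 0])).
  exact: ker_iter_subspace.
move=> x /C1_gen_nat [i [v [n [w [hw [-> hs]]]]]] /=.
have Emu : mu - i.+1%:R / T3%:R + i.+1%:R / T3%:R = mu by rewrite subrK.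
rewrite (iter_intertwine (D := shift (Lop (@gtw_Y _ _ _ M) 0) (mu - i.+1%:R / T3%:R))).
  by rewrite (hK i M Z w hZ sZ hw) (lin0 (tw_linear_r (gtm_weak (gtw_axioms M)) _ _)).
by move=> y; rewrite -hs Emu.
Qed.

(** By [log_degree_bound], the uniform nilpotency of L(0) - mu bounds the powers of log x
    uniformly. *)
Lemma log_bound mu l1 w1 l2 w2 : hom1 l1 w1 -> hom2 l2 w2 ->
  exists K : nat, forall (M : gtwmod g3) Z k,
  intertwining M Z -> surjective_op Z -> (K <= k)%N -> coef l1 w1 l2 w2 Z mu k = 0.
Proof.
move=> h1 h2; have [m hm] := nilpotency_bound mu.
have [[p hp] [q hq]] := (h1, h2); exists (p + q + m)%N => M Z k hZ sZ hk.
have lL := Lop_linear (gtm_weak (gtw_axioms M)) 0.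
apply: (@log_degree_bound _ _ _ _ (shift (Lop Y1 0) l1) (shift (Lop Y2 0) l2)
  (shift (Lop (@gtw_Y _ _ _ M) 0) mu)
  (fun k w1 w2 => coef l1 w1 l2 w2 Z mu k) _ _ _ _ _ p q m 0) => //.
- by move=> k' w; rewrite /coef (lin0 (io_linear_l hZ _ _ _)).
- by move=> k' w; rewrite /coef (lin0 (io_linear_r hZ _ _ _)).
- exact: shift_linear.
- by move=> k' u1 u2; exact: (io_shift a1 a2 f1 f2 hZ).
- by move=> j; rewrite pnatr_eq0.
- move=> s t; apply: (hm M Z) => //.
  apply: (io_gen a1 a2 f1 f2 (gtw_axioms M) wY1 wY2 hZ); apply: iter_stable => // x.
    exact: gen_eigenspace_shift (Lop_linear wY1 _).
  exact: gen_eigenspace_shift (Lop_linear wY2 _).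
by rewrite addn0.
Qed.

End Basis.

Lemma uniform_finiteness : C1_cofinite W1 -> C1_cofinite W2 ->
  [/\ forall mu, exists d : nat, forall (M : gtwmod g3) Z (j : nat) u,
        intertwining M Z -> surjective_op Z -> (d <= j)%N ->
        hom M (mu - j%:R / T3%:R) u -> u = 0,
      forall mu, exists K : nat, forall (M : gtwmod g3) Z u,
        intertwining M Z -> surjective_op Z -> hom M mu u ->
        iter K (shift (Lop (@gtw_Y _ _ _ M) 0) mu) u = 0
    & forall mu l1 w1 l2 w2, hom1 l1 w1 -> hom2 l2 w2 ->
      exists K : nat, forall (M : gtwmod g3) Z k,
        intertwining M Z -> surjective_op Z -> (K <= k)%N ->
        coef l1 w1 l2 w2 Z mu k = 0].
Proof.
move=> c1 c2.
have [A1 [A1h A1g]] := hom_generators a1 a2 f1 f2 (fun v => esym (gC v)) c1.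
have [A2 [A2h A2g]] := hom_generators a2 a1 f2 f1 gC c2.
(* b0 makes the index set of the matrices nonempty. *)
pose b0 : (C * W1) * (C * W2) := ((0, 0), (0, 0)).
pose s := [seq (p, q) | p <- A1, q <- A2].
pose B (i : 'I_(size s).+1) := nth b0 s i.
have Bs i : B i = b0 \/ exists p q, [/\ p \in A1, q \in A2 & B i = (p, q)].
  have [lt|ge] := ltnP i (size s); last by left; rewrite /B nth_default.
  by right; have /allpairsP [[p q] [/= ? ? ?]] := mem_nth b0 lt; exists p, q.
have L1 := gen_eigenspace_subspace _ (Lop_linear wY1 0).
have L2 := gen_eigenspace_subspace _ (Lop_linear wY2 0).
have B1 i : hom1 (B i).1.1 (B i).1.2.
  by have [->|[p [q [pA _ ->]]]] := Bs i; [have [] := L1 0|exact: A1h].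
have B2 i : hom2 (B i).2.1 (B i).2.2.
  by have [->|[p [q [_ qA ->]]]] := Bs i; [have [] := L2 0|exact: A2h].
have BA p q : p \in A1 -> q \in A2 -> exists i, B i = (p, q).
  move=> pA qA; have ps : (p, q) \in s by apply/allpairsP; exists (p, q).
  have lt : (index (p, q) s < (size s).+1)%N by rewrite ltnS index_size.
  by exists (Ordinal lt); rewrite /B /= nth_index.
have redB l1 w1 l2 w2 : hom1 l1 w1 -> hom2 l2 w2 -> reducible B (coef l1 w1 l2 w2).
  exact: (hom_reducible A1g A2g A1h BA).
have [chi [chi0 hchi]] := log_vanishing B1 B2 redB.
split=> [mu|mu|mu l1 w1 l2 w2 h1 h2].
- have [d hd] := root_bound chi0 mu.
  exists d => M Z j u hZ sZ dj hu; apply: (weights_zero chi0 hchi hZ sZ _ hu) => i.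
  rewrite -addrA -opprD -mulrDl -natrD; apply: hd; exact: leq_trans dj (leq_addr _ _).
- exact: (nilpotency_bound B1 B2 redB chi0 hchi).
exact: (log_bound B1 B2 redB chi0 hchi).
Qed.

(** * The span of the coefficients of a family of operators *)

Section Family.
Variables (I : Type) (M : I -> gtwmod g3).
Variable Z : forall i, W1 -> C -> nat -> W2 -> M i.
Hypothesis hZ : forall i, intertwining (M i) (Z i).

(** These definitions unfold to those of [diamond] for an arbitrary family of operators, so that
    they cover both the chosen representatives and the image of a single operator. *)
Definition fam_prod : lmodType C := dprod (fun i => M i : lmodType C).

Definition fam_Y (v : V) (n : rat) (s : fam_prod) : fam_prod :=
  fun i => gtw_Y v n (s i).

Definition fam_coef (w1 : W1) (n : C) (k : nat) (w2 : W2) : fam_prod :=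
  fun i => Z i w1 n k w2.

Definition fam_span : lmodType C := span_of (coefficients fam_coef).

Definition fam_span_Y (v : V) (n : rat) (d : fam_span) : fam_span :=
  insubd (0 : span_of (coefficients fam_coef)) (fam_Y v n (span_val d)).

Definition fam_span_op (w1 : W1) (n : C) (k : nat) (w2 : W2) : fam_span :=
  SpanOf (mem_in_span
    (ex_intro _ w1 (ex_intro _ n (ex_intro _ k (ex_intro _ w2 erefl)))
      : coefficients fam_coef (fam_coef w1 n k w2))).

Hypothesis weights_fam : forall mu, exists d : nat, forall i (j : nat) u,
  (d <= j)%N -> hom (M i) (mu - j%:R / T3%:R) u -> u = 0.
Hypothesis nilp_fam : forall mu l1 w1 l2 w2 k, hom1 l1 w1 -> hom2 l2 w2 ->
  exists K : nat, forall i,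
  iter K (shift (Lop (@gtw_Y _ _ _ (M i)) 0) mu) (coef l1 w1 l2 w2 (Z i) mu k) = 0.
Hypothesis log_fam : forall mu l1 w1 l2 w2, hom1 l1 w1 -> hom2 l2 w2 ->
  exists K : nat, forall i k, (K <= k)%N -> coef l1 w1 l2 w2 (Z i) mu k = 0.

Let zl i := io_linear_l (hZ i).
Let zr i := io_linear_r (hZ i).
Let wM i : weak_twisted_module g3 (@gtw_Y _ _ _ (M i)) := gtm_weak (gtw_axioms (M i)).
Local Notation LS := (linspan (coefficients fam_coef)).
Let LSs : subspace LS := linspan_is_subspace _.

Lemma fam_ext (s t : fam_prod) : (forall i, s i = t i) -> s = t.
Proof. by move=> st; apply: functional_extensionality_dep. Qed.

Lemma fam_component_linear i : linear (fun s : fam_prod => s i).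
Proof. by []. Qed.

Lemma fam_sumE (X : Type) (r : seq X) (P : pred X) (F : X -> fam_prod) i :
  (\sum_(x <- r | P x) F x) i = \sum_(x <- r | P x) F x i.
Proof. exact: (lin_sum (fam_component_linear i)). Qed.

Lemma fam_coef_linear_l n k w2 : linear (fun w1 => fam_coef w1 n k w2).
Proof. by move=> a u v; apply: fam_ext => i; exact: zl. Qed.

Lemma fam_coef_linear_r w1 n k : linear (fam_coef w1 n k).
Proof. by move=> a u v; apply: fam_ext => i; exact: zr. Qed.

Lemma fam_Y_linear_l n s : linear (fun v => fam_Y v n s).
Proof. by move=> a u v; apply: fam_ext => i; exact: (tw_linear_l (wM i)). Qed.

Lemma fam_Y_linear_r v n : linear (fam_Y v n).
Proof. by move=> a s t; apply: fam_ext => i; exact: (tw_linear_r (wM i)). Qed.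

Lemma fam_trunc w1 w2 n : exists N : nat, forall j k, (N <= j)%N ->
  fam_coef w1 (n + j%:R) k w2 = 0.
Proof.
pose P w1 w2 := exists N : nat, forall j k, (N <= j)%N -> fam_coef w1 (n + j%:R) k w2 = 0.
suff : P w1 w2 by [].
move: w1; apply: (graded_ind (gtm_sum (gtw_axioms W1))).
  split=> [|u v [N1 h1] [N2 h2]|a u [N1 h1]].
  - by exists 0%N => j k _; rewrite (lin0 (fam_coef_linear_l _ _ _)).
  - exists (maxn N1 N2) => j k; rewrite geq_max => /andP [? ?].
    by rewrite (linD (fam_coef_linear_l _ _ _)) h1 ?h2 ?addr0.
  by exists N1 => j k ?; rewrite (linZ (fam_coef_linear_l _ _ _)) h1 ?scaler0.
move=> l1 w1 h1; move: w2; apply: (graded_ind (gtm_sum (gtw_axioms W2))).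
  split=> [|u v [N1 k1] [N2 k2]|a u [N1 k1]].
  - by exists 0%N => j k _; rewrite (lin0 (fam_coef_linear_r _ _ _)).
  - exists (maxn N1 N2) => j k; rewrite geq_max => /andP [? ?].
    by rewrite (linD (fam_coef_linear_r _ _ _)) k1 ?k2 ?addr0.
  by exists N1 => j k ?; rewrite (linZ (fam_coef_linear_r _ _ _)) k1 ?scaler0.
move=> l2 w2 h2; have [d hd] := weights_fam (l1 + l2 - 1 - n).
exists d => j k dj; apply: fam_ext => i.
(* [weights_fam] descends in steps of 1/T3, so lowering the weight by j takes j T3 of them. *)
apply: (hd i (j * T3)%N).
  by rewrite (leq_trans dj) // leq_pmulr //; case: (ord_ofP f3).
rewrite natrM mulfK ?T3n //.
have := io_gen a1 a2 f1 f2 (gtw_axioms (M i)) wY1 wY2 (hZ i) (l1 + l2 - 1 - n - j%:R) k h1 h2.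
by have -> : l1 + l2 - 1 - (l1 + l2 - 1 - n - j%:R) = n + j%:R by ring.
Qed.

Lemma fam_log w1 w2 n : exists K : nat, forall k, (K <= k)%N ->
  fam_coef w1 n k w2 = 0.
Proof.
pose P w1 w2 := exists N : nat, forall k, (N <= k)%N -> fam_coef w1 n k w2 = 0.
suff : P w1 w2 by [].
move: w1; apply: (graded_ind (gtm_sum (gtw_axioms W1))).
  split=> [|u v [N1 h1] [N2 h2]|a u [N1 h1]].
  - by exists 0%N => k _; rewrite (lin0 (fam_coef_linear_l _ _ _)).
  - exists (maxn N1 N2) => k; rewrite geq_max => /andP [? ?].
    by rewrite (linD (fam_coef_linear_l _ _ _)) h1 ?h2 ?addr0.
  by exists N1 => k ?; rewrite (linZ (fam_coef_linear_l _ _ _)) h1 ?scaler0.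
move=> l1 w1 h1; move: w2; apply: (graded_ind (gtm_sum (gtw_axioms W2))).
  split=> [|u v [N1 k1] [N2 k2]|a u [N1 k1]].
  - by exists 0%N => k _; rewrite (lin0 (fam_coef_linear_r _ _ _)).
  - exists (maxn N1 N2) => k; rewrite geq_max => /andP [? ?].
    by rewrite (linD (fam_coef_linear_r _ _ _)) k1 ?k2 ?addr0.
  by exists N1 => k ?; rewrite (linZ (fam_coef_linear_r _ _ _)) k1 ?scaler0.
move=> l2 w2 h2; have [K hK] := log_fam (l1 + l2 - 1 - n) h1 h2.
exists K => k Kk; apply: fam_ext => i; have := hK i k Kk; rewrite /coef.
by have -> : l1 + l2 - 1 - (l1 + l2 - 1 - n) = n by ring.
Qed.

Lemma LS_coef w1 n k w2 : LS (fam_coef w1 n k w2).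
Proof. by apply: linspan_subset; exists w1, n, k, w2. Qed.

(** The Jacobi identity at l = -a, m = p + a is solved for its leading term. The other terms with v
    acting outside the operator have larger n, and truncation uniform in the components permits
    induction on the number [d] of steps before they vanish. *)
Lemma fam_Y_coef v p w1 n k w2 : LS (fam_Y v p (fam_coef w1 n k w2)).
Proof.
pose P := [set v | forall p w1 n k w2, LS (fam_Y v p (fam_coef w1 n k w2))].
suff : P v by apply.
have [L0 LD LZ] := LSs.
apply: (twist2_ind a1 a2 f1 f2 gC) => [|r1 r2 h {}v r1T r2T v1 v2 _ {}p {}w1 {}n {}k {}w2].
  split=> [p' u n' k' w|u u' hu hu' p' w n' k' w'|a u hu p' w n' k' w'].
  - by rewrite (lin0 (fam_Y_linear_l _ _)).
  - by rewrite (linD (fam_Y_linear_l _ _)); exact: LD.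
  by rewrite (linZ (fam_Y_linear_l _ _)); exact: LZ.
have [->|v0] := eqVneq v 0; first by rewrite (lin0 (fam_Y_linear_l _ _)).
have [lg1 _ _ _ _] := a1; have [lg2 _ _ _ _] := a2.
have [r3 [r3T v3 [c [Ec _]]]] := twist_comp v0 lg1 lg2 f3 r1T r2T v1 v2.
set a : rat := r1%:R / T1%:R in Ec; set b : rat := r2%:R / T2%:R in Ec.
have [d hd] := fam_trunc w1 w2 n.
have {hd} hd j : (d <= j)%N -> fam_coef w1 (n + j%:R) k w2 = 0 by exact: hd.
elim: d p n hd => [|d IHd] p n hd.
  by have := hd 0%N isT; rewrite addr0 => ->; rewrite (lin0 (fam_Y_linear_r _ _)).
have [pi|pi] := boolP (p + a + b \is a Num.int); last first.
  suff -> : fam_Y v p (fam_coef w1 n k w2) = 0 by [].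
  apply: fam_ext => i; apply: (tw_coset (wM i) _ r3T v3).
  by apply: contra pi => pi; rewrite -addrA Ec addrA rpredD // natr_int.
have [N [hN1 hN2]] : exists N : nat,
    (forall i, (N <= i)%N -> gtw_Y v (- a + i%:R) w1 = 0) /\
    (forall i, (N <= i)%N -> gtw_Y v (p + a + i%:R) w2 = 0).
  have [N1 h1] := tw_trunc_nat a1 f1 wY1 v w1 (- a).
  have [N2 h2] := tw_trunc_nat a2 f2 wY2 v w2 (p + a).
  exists (maxn N1 N2); split=> i; rewrite geq_max => /andP [? ?]; [exact: h1|exact: h2].
pose S1 := \sum_(i < d) ((-1) ^+ i.+1 * binom (ratr (- a)) i.+1) *:
  fam_Y v (p - i.+1%:R) (fam_coef w1 (n + i.+1%:R) k w2).
pose S2 := \sum_(i < N) (expipi R (- a - i%:R) * binom (ratr (- a)) i) *: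
  fam_coef w1 (n + ratr (- a) - i%:R) k (gtw_Y v (p + a + i%:R) w2).
pose S3 := \sum_(i < N) binom (ratr (p + a)) i *:
  fam_coef (gtw_Y v (- a + i%:R) w1) (ratr (p + a) + n - i%:R) k w2.
have -> : fam_Y v p (fam_coef w1 n k w2) = S3 + S2 - S1.
  apply: fam_ext => i.
  have -> : (S3 + S2 - S1) i = S3 i + S2 i - S1 i by [].
  rewrite /S1 /S2 /S3 !fam_sumE.
  have := io_jacobi (hZ i) w1 w2 (- a) (p + a) n k r1T r2T v1 v2.
  rewrite addNr int_num0 pi.
  rewrite (fsum_nat (N := d.+1)) => [|j hj]; last first.
    have := hd j hj => /(congr1 (fun s : fam_prod => s i)) /= => ej.
    by rewrite [Z i _ _ _ _]ej (lin0 (tw_linear_r (wM i) _ _)) scaler0.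
  rewrite (fsum_nat (N := N)) => [|j hj]; last by rewrite hN2 // (lin0 (zr _ _ _ _)) scaler0.
  rewrite (fsum_nat (N := N)) => [|j hj]; last by rewrite hN1 // (lin0 (zl _ _ _ _)) scaler0.
  rewrite big_ord_recl binom0 mulr1 scale1r !addr0 addrK ?subr0.
  move/eqP; rewrite subr_eq => /eqP /(canRL (addrK _)).
  exact.
apply: subspaceB => //; first apply: LD; apply: subspace_sum => // i _ _; apply: LZ.
- exact: LS_coef.
- exact: LS_coef.
apply: IHd => j dj; rewrite -addrA -natrD; apply: hd.
by rewrite addSn ltnS (leq_trans dj) // leq_addl.
Qed.

Lemma fam_Y_span v n s : LS s -> LS (fam_Y v n s).
Proof.
apply: (linspan_sub (subspace_preim (fam_Y_linear_r v n) LSs)).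
by move=> x [w1 [m [k [w2 ->]]]]; exact: fam_Y_coef.
Qed.

Definition fam_ev (i : I) (d : fam_span) : M i := span_val d i.

Lemma fam_ev_linear i : linear (@fam_ev i).
Proof.
move=> a d d'; rewrite /fam_ev.
have -> : span_val (a *: d + d' : fam_span) = a *: span_val d + span_val d' by [].
by [].
Qed.

Lemma fam_ev_inj d d' : (forall i, fam_ev i d = fam_ev i d') -> d = d'.
Proof. by move=> dd'; apply: val_inj; apply: fam_ext. Qed.

Lemma fam_span_val (d : fam_span) : LS (span_val d).
Proof. by apply/asboolP; case: d. Qed.

Lemma fam_span_YE v n (d : fam_span) : span_val (fam_span_Y v n d) = fam_Y v n (span_val d).
Proof.
rewrite /fam_span_Y -[span_val _]/(val _) insubdK //; apply/asboolP.
exact: fam_Y_span (fam_span_val d).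
Qed.

Lemma fam_ev_Y i v n d : fam_ev i (fam_span_Y v n d) = gtw_Y v n (fam_ev i d).
Proof. by rewrite /fam_ev fam_span_YE. Qed.

Lemma fam_ev_op i w1 n k w2 : fam_ev i (fam_span_op w1 n k w2) = Z i w1 n k w2.
Proof. by []. Qed.

Lemma fam_span_Y_linear_l n d : linear (fun v => fam_span_Y v n d).
Proof.
move=> a u v; apply: fam_ev_inj => i.
by rewrite fam_ev_linear !fam_ev_Y (tw_linear_l (wM i)).
Qed.

Lemma fam_span_Y_linear_r v n : linear (fam_span_Y v n).
Proof.
move=> a u d; apply: fam_ev_inj => i.
by rewrite fam_ev_linear !fam_ev_Y fam_ev_linear (tw_linear_r (wM i)).
Qed.

Lemma fam_span_op_linear_l n k w2 : linear (fun w1 => fam_span_op w1 n k w2).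
Proof.
by move=> a u v; apply: fam_ev_inj => i; rewrite fam_ev_linear !fam_ev_op zl.
Qed.

Lemma fam_span_op_linear_r w1 n k : linear (fam_span_op w1 n k).
Proof.
by move=> a u v; apply: fam_ev_inj => i; rewrite fam_ev_linear !fam_ev_op zr.
Qed.

Lemma fam_span_surj : surjective_op fam_span_op.
Proof.
rewrite /surjective_op -subTset => d _.
have [s [hs Es]] := fam_span_val d.
have : forall p : C * fam_prod, exists d : fam_span,
    p \in s -> coefficients fam_span_op d /\ span_val d = p.2.
  move=> p; have [ps|] := boolP (p \in s); last by exists 0.
  have [w1 [n [k [w2 Ep]]]] := hs p ps.
  by exists (fam_span_op w1 n k w2) => _; split=> //; exists w1, n, k, w2.
move=> /choice [f hf].
exists [seq (p.1, f p) | p <- s]; split=> [p /mapP [q qs ->]|].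
  by have [] := hf q qs.
rewrite big_map; apply: fam_ev_inj => i; rewrite (lin_sum (fam_ev_linear i)).
rewrite {1}/fam_ev Es fam_sumE; apply: eq_big_seq => p ps.
by rewrite (linZ (fam_ev_linear i)) /fam_ev (hf p ps).2.
Qed.

Lemma fam_span_ind (P : set fam_span) : subspace P ->
  (forall w1 n k w2, P (fam_span_op w1 n k w2)) -> forall d, P d.
Proof.
move=> sP hP d; have : linspan (coefficients fam_span_op) d by rewrite fam_span_surj.
by apply: linspan_sub => // x [w1 [n [k [w2 ->]]]].
Qed.

Lemma fam_span_hom_ind (P : set fam_span) : subspace P ->
  (forall l1 w1 l2 w2 n k, hom1 l1 w1 -> hom2 l2 w2 -> P (fam_span_op w1 n k w2)) ->
  forall d, P d.
Proof.
move=> sP hP; apply: fam_span_ind => //.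
exact: (coef_ind fam_span_op_linear_l fam_span_op_linear_r sP hP).
Qed.

Lemma fam_span_trunc v d : exists N : rat, forall n, N <= n -> fam_span_Y v n d = 0.
Proof.
pose P d v := exists N : rat, forall n, N <= n -> fam_span_Y v n d = 0.
suff : P d v by [].
move: v; apply: (graded_ind (voa_gr_sum V)) => [|h v hv].
  split=> [|u v [N1 h1] [N2 h2]|a u [N1 h1]].
  - by exists 0 => n _; rewrite (lin0 (fam_span_Y_linear_l _ _)).
  - exists (Num.max N1 N2) => n; rewrite ge_max => /andP [? ?].
    by rewrite (linD (fam_span_Y_linear_l _ _)) h1 ?h2 ?addr0.
  by exists N1 => n ?; rewrite (linZ (fam_span_Y_linear_l _ _)) h1 ?scaler0.
move: d; apply: fam_span_hom_ind.
  split=> [|u u' [N1 h1] [N2 h2]|a u [N1 h1]].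
  - by exists 0 => n _; rewrite (lin0 (fam_span_Y_linear_r _ _)).
  - exists (Num.max N1 N2) => n; rewrite ge_max => /andP [? ?].
    by rewrite (linD (fam_span_Y_linear_r _ _)) h1 ?h2 ?addr0.
  by exists N1 => n ?; rewrite (linZ (fam_span_Y_linear_r _ _)) h1 ?scaler0.
move=> l1 w1 l2 w2 m k h1 h2.
pose mu := l1 + l2 - 1 - m; have [d hd] := weights_fam (mu + h%:~R - 1).
have T3gt : (0 < T3)%N by case: (ord_ofP f3).
(* Modes outside (1/T3)Z vanish. For n = q/T3 the components have weight mu + h - 1 - q/T3, and q =
   T3 n >= n >= d. *)
exists d%:R => n dn; apply: fam_ev_inj => i; rewrite fam_ev_Y fam_ev_op (lin0 (fam_ev_linear i)).
have [/intrP [q Eq]|ni] := boolP (T3%:R * n \is a Num.int); last exact: (tw_support (wM i)).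
have En : n = q%:~R / T3%:R by rewrite -Eq mulrC mulKf // pnatr_eq0 -lt0n.
have dq : (d%:Z <= q).
  rewrite -(ler_int rat) -Eq -pmulrn (le_trans dn) // ler_peMl ?ler1n //.
  exact: le_trans dn.
apply: (hd i `|q|%N); first lia.
have := io_gen a1 a2 f1 f2 (gtw_axioms (M i)) wY1 wY2 (hZ i) mu k h1 h2.
have -> : l1 + l2 - 1 - mu = m by rewrite /mu; ring.
move=> /(tw_mode_gen a3 f3 (wM i) n hv); congr (gen_eigenspace _ _ _).
rewrite En fmorph_div rmorph_int rmorph_nat -[in LHS](@gez0_abs q); last by lia.
by rewrite -pmulrn; move: (_ / _) => x; ring.
Qed.

Lemma fam_ev_fsum i (F : nat -> fam_span) :
  (exists N, forall j, (N <= j)%N -> F j = 0) ->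
  fam_ev i (\sum_(j \in [set: nat]) F j) = \sum_(j \in [set: nat]) fam_ev i (F j).
Proof. exact: lin_fsum (fam_ev_linear i). Qed.

Lemma fam_span_trunc_nat v (n : rat) d : exists N : nat, forall i, (N <= i)%N ->
  fam_span_Y v (n + i%:R) d = 0.
Proof.
have [N hN] := fam_span_trunc v d.
exists (Num.truncn `|N - n|).+1 => i hi; apply: hN.
have := truncnS_gt `|N - n|; rewrite -(ler_nat rat) in hi => h.
have := ler_norm (N - n); move: h hi; lra.
Qed.

(** The axioms hold componentwise. For the Jacobi identity, evaluation at a component has to commute
    with the sums over i, which truncation in the span itself guarantees. *)
Lemma fam_span_weak : weak_twisted_module g3 fam_span_Y.
Proof.
split.
- exact: fam_span_Y_linear_l.
- exact: fam_span_Y_linear_r.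
- move=> v n d hn; apply: fam_ev_inj => i.
  by rewrite fam_ev_Y (lin0 (fam_ev_linear i)) (tw_support (wM i)).
- move=> n d; apply: fam_ev_inj => i; rewrite fam_ev_Y (tw_vacuum (wM i)).
  by case: ifP => // _; rewrite (lin0 (fam_ev_linear i)).
- move=> r u n d rT hu hn; apply: fam_ev_inj => i.
  by rewrite fam_ev_Y (lin0 (fam_ev_linear i)) (tw_coset (wM i) _ rT hu hn).
- by move=> r u d _ _; exact: fam_span_trunc.
move=> r v u d l m n rT hv; apply: fam_ev_inj => i.
have lYr v' n' := lin0 (fam_span_Y_linear_r v' n').
rewrite (linB (fam_ev_linear i)) !fam_ev_fsum; last 2 first.
- have [N hN] := fam_span_trunc_nat v m d; exists N => j Nj.
  by rewrite hN // lYr scaler0.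
- have [N hN] := fam_span_trunc_nat u n d; exists N => j Nj.
  by rewrite hN // lYr scaler0.
have := tw_jacobi (wM i) u (fam_ev i d) l m n rT hv.
rewrite (_ : fam_ev i (if _ then _ else _) = if m + r%:R / T3%:R \is a Num.int then
   \sum_(j \in [set: nat]) binom (ratr m) j *:
     gtw_Y (voa_Y v (l + j%:Z) u) (m + n - j%:R) (fam_ev i d) else 0); last first.
  case: ifP => // _.
  rewrite fam_ev_fsum.
    by apply: eq_fsbigr => j _; rewrite (linZ (fam_ev_linear i)) fam_ev_Y.
  have [N hN] := voa_Y_trunc v u; exists `|N - l|%N => j Nj.
  by rewrite hN ?(lin0 (fam_span_Y_linear_l _ _)) ?scaler0 //; lia.
move=> <-; congr (_ - _); apply: eq_fsbigr => j _;
  by rewrite (linZ (fam_ev_linear i)) !fam_ev_Y.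
Qed.

Lemma fam_ev_Lop i n d : fam_ev i (Lop fam_span_Y n d) = Lop (@gtw_Y _ _ _ (M i)) n (fam_ev i d).
Proof. exact: fam_ev_Y. Qed.

Lemma fam_ev_shift i k mu d : fam_ev i (iter k (shift (Lop fam_span_Y 0) mu) d) =
  iter k (shift (Lop (@gtw_Y _ _ _ (M i)) 0) mu) (fam_ev i d).
Proof.
apply/esym/iter_intertwine => x.
by rewrite {2}/shift (linB (fam_ev_linear i)) (linZ (fam_ev_linear i)) fam_ev_Lop.
Qed.

Lemma fam_ev_gen i mu d : gen_eigenspace (Lop fam_span_Y 0) mu d -> hom (M i) mu (fam_ev i d).
Proof.
move=> [k hk]; exists k; have := fam_ev_shift i k mu d.
rewrite /shift => <-; rewrite hk; exact: lin0 (fam_ev_linear i).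
Qed.

(** One nilpotency exponent for all components makes a coefficient of a homogeneous pair a
    generalized eigenvector in the span. Independence and the lower bound on weights are checked in
    each component. *)
Lemma fam_span_generalized : generalized_twisted_module g3 fam_span_Y.
Proof.
have lL := Lop_linear fam_span_weak 0.
split; first exact: fam_span_weak.
  split=> [mu|d|s f us hf Es mu mus].
  - exact: gen_eigenspace_subspace.
  - apply: span_decomposition => [mu|]; first exact: gen_eigenspace_subspace.
    move: d; apply: fam_span_hom_ind; first exact: linspan_is_subspace.
    move=> l1 w1 l2 w2 n k h1 h2; apply: linspan_subset.
    exists (l1 + l2 - 1 - n); have [K hK] := nilp_fam (l1 + l2 - 1 - n) k h1 h2.
    exists K; rewrite -[iter _ _ _]/(iter K (shift (Lop fam_span_Y 0) (l1 + l2 - 1 - n)) _).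
    apply: fam_ev_inj => i; rewrite fam_ev_shift fam_ev_op (lin0 (fam_ev_linear i)).
    have := hK i; rewrite /coef.
    by have -> : l1 + l2 - 1 - (l1 + l2 - 1 - n) = n by ring.
  apply: fam_ev_inj => i; rewrite (lin0 (fam_ev_linear i)).
  have [_ _ indep] := gtm_sum (gtw_axioms (M i)).
  apply: (indep s (fun mu => fam_ev i (f mu))) => // [j|].
    exact: fam_ev_gen.
  by rewrite -(lin_sum (fam_ev_linear i)) Es (lin0 (fam_ev_linear i)).
move=> mu; have [d hd] := weights_fam mu; exists (- d%:Z) => n hn x hx /=.
apply: fam_ev_inj => i; rewrite (lin0 (fam_ev_linear i)).
apply: (hd i `|n|%N); first lia.
have := fam_ev_gen i hx; congr (gen_eigenspace _ _ _).
have -> : n = - `|n|%N%:Z by lia.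
by rewrite mulrNz mulNr abszN.
Qed.

Lemma fam_span_intertwining : intertwining_operator g1 g2 Y1 Y2 fam_span_Y fam_span_op.
Proof.
split.
- exact: fam_span_op_linear_l.
- exact: fam_span_op_linear_r.
- move=> w1 w2 n; have [K hK] := fam_log w1 w2 n; exists K => k Kk.
  by apply: val_inj; exact: hK.
- move=> w1 w2 n; have [N hN] := fam_trunc w1 w2 n; exists N => j k Nj.
  by apply: val_inj; exact: hN.
- move=> r1 r2 v w1 w2 l m n k r1T r2T v1 v2; apply: fam_ev_inj => i.
  have := io_jacobi (hZ i) w1 w2 l m n k r1T r2T v1 v2.
  rewrite (_ : fam_ev i (if m + _ \is a Num.int then _ else _) =
    if m + r2%:R / T2%:R \is a Num.int then
      \sum_(j \in [set: nat]) binom (ratr m) j *: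
        Z i (gtw_Y v (l + j%:R) w1) (ratr m + n - j%:R) k w2 else 0); last first.
    case: ifP => // _.
    rewrite fam_ev_fsum.
      by apply: eq_fsbigr => j _; rewrite (linZ (fam_ev_linear i)) fam_ev_op.
    have [N hN] := tw_trunc_nat a1 f1 wY1 v w1 l; exists N => j Nj.
    by rewrite hN // (lin0 (fam_span_op_linear_l _ _ _)) scaler0.
  move=> <-; case: ifP => // _.
  rewrite (linB (fam_ev_linear i)) !fam_ev_fsum; last 2 first.
  + have [N hN] := tw_trunc_nat a2 f2 wY2 v w2 m; exists N => j Nj.
    by rewrite hN // (lin0 (fam_span_op_linear_r _ _ _)) scaler0.
  + have [N hN] := fam_trunc w1 w2 n; exists N => j Nj.
    have -> : fam_span_op w1 (n + j%:R) k w2 = 0 by apply: val_inj; exact: hN.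
    by rewrite (lin0 (fam_span_Y_linear_r _ _)) scaler0.
  congr (_ - _); apply: eq_fsbigr => j _;
    by rewrite (linZ (fam_ev_linear i)) ?fam_ev_Y fam_ev_op.
move=> w1 n k w2; apply: fam_ev_inj => i.
rewrite (linD (fam_ev_linear i)) !(linZ (fam_ev_linear i)) !fam_ev_op.
exact: (io_Lm1 (hZ i)).
Qed.

End Family.
End Modules.

(** * The fusion product *)

Lemma linear_inverse (K : fieldType) (U W : lmodType K) (f : U -> W) (h : W -> U) :
  linear f -> cancel f h -> cancel h f -> linear h.
Proof. by move=> lf fK hK a u v; apply: (can_inj fK); rewrite lf !hK. Qed.

Lemma op_image_fpair (R : realType) (V : voa R) (g1 g2 : V -> V)
  (a1 : voa_automorphism g1) (a2 : voa_automorphism g2)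
  (f1 : finite_order g1) (f2 : finite_order g2)
  (gC : forall v, g1 (g2 v) = g2 (g1 v))
  (W1 : gtwmod g1) (W2 : gtwmod g2) (M : gtwmod (g1 \o g2))
  (Z : W1 -> R[i] -> nat -> W2 -> M) :
  intertwining_operator g1 g2 (@gtw_Y _ _ _ W1) (@gtw_Y _ _ _ W2)
    (@gtw_Y _ _ _ M) Z ->
  exists (p : fpair W1 W2) (f : p -> M),
    twisted_hom (@gtw_Y _ _ _ p) (@gtw_Y _ _ _ M) f
    /\ forall w1 n k w2, f (fp_op p w1 n k w2) = Z w1 n k w2.
Proof.
move=> hZ.
(* The image of Z is the span of the one-element family. *)
pose Z' (_ : unit) := Z; pose M' (_ : unit) := M.
have hZ' i : intertwining_operator g1 g2 (@gtw_Y _ _ _ W1) (@gtw_Y _ _ _ W2)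
    (@gtw_Y _ _ _ (M' i)) (Z' i) by [].
(* For a single module the uniform bounds come from [gtm_low], [io_gen] and [io_log], applied to [M]
   and [Z]. *)
have wf mu : exists d : nat, forall (i : unit) (j : nat) u, (d <= j)%N ->
    gen_eigenspace (Lop (@gtw_Y _ _ _ (M' i)) 0)
      (mu - j%:R / (ord_of (g1 \o g2))%:R) u -> u = 0.
  have [m hm] := gtm_low (gtw_axioms M) mu; exists `|m|%N => i j u dj hu.
  by apply: (hm (- j%:Z)); [lia|rewrite mulrNz mulNr].
have nf mu l1 w1 l2 w2 k :
    gen_eigenspace (Lop (@gtw_Y _ _ _ W1) 0) l1 w1 ->
    gen_eigenspace (Lop (@gtw_Y _ _ _ W2) 0) l2 w2 ->
    exists K : nat, forall i : unit,
    iter K (shift (Lop (@gtw_Y _ _ _ (M' i)) 0) mu) (coef l1 w1 l2 w2 (Z' i) mu k) = 0.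
  move=> h1 h2.
  have [K hK] := io_gen a1 a2 f1 f2 (gtw_axioms M) (gtm_weak (gtw_axioms W1))
    (gtm_weak (gtw_axioms W2)) hZ mu k h1 h2.
  by exists K.
have lf mu l1 w1 l2 w2 :
    gen_eigenspace (Lop (@gtw_Y _ _ _ W1) 0) l1 w1 ->
    gen_eigenspace (Lop (@gtw_Y _ _ _ W2) 0) l2 w2 ->
    exists K : nat, forall (i : unit) k, (K <= k)%N ->
    coef l1 w1 l2 w2 (Z' i) mu k = 0.
  by move=> _ _; have [K hK] := io_log hZ w1 w2 (l1 + l2 - 1 - mu); exists K.
have gU := fam_span_generalized a1 a2 f1 f2 gC hZ' wf nf.
have iU := fam_span_intertwining a1 a2 f1 f2 gC hZ' wf lf.
pose p := @FPair _ _ _ _ W1 W2 (GTwMod gU) (fam_span_op Z')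
  (And3 gU iU (fam_span_surj Z')).
exists p, (fam_ev tt); split=> //; split; first exact: fam_ev_linear.
by move=> v n u; exact: (fam_ev_Y a1 a2 f1 f2 gC hZ' wf).
Qed.

Theorem theorem2 (R : realType) (V : voa R) (g1 g2 : V -> V)
  (hg1 : voa_automorphism g1) (hg2 : voa_automorphism g2)
  (fg1 : finite_order g1) (fg2 : finite_order g2)
  (g12 : forall v, g1 (g2 v) = g2 (g1 v))
  (W1 : gtwmod g1) (W2 : gtwmod g2)
  (cW1 : C1_cofinite W1) (cW2 : C1_cofinite W2)
  (I : Type) (F : I -> fpair W1 W2) (hF : representatives F) :
  [/\ forall (v : V) (n : rat) (d : diamond F),
        diamond_val (diamond_Y F v n d) = S_Y v n (diamond_val d),
      fusion_pair (diamond_Y F) (diamond_op F)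
    & is_fusion_product (diamond_Y F) (diamond_op F)].
Proof.
have [wf0 nf0 lf0] := uniform_finiteness hg1 hg2 fg1 fg2 g12 cW1 cW2.
have hZ i : intertwining_operator g1 g2 (@gtw_Y _ _ _ W1) (@gtw_Y _ _ _ W2)
    (@gtw_Y _ _ _ (F i)) (@fp_op _ _ _ _ _ _ (F i)).
  by have [] := fp_axioms (F i).
have sZ i : surjective_op (@fp_op _ _ _ _ _ _ (F i)) by have [] := fp_axioms (F i).
have wf mu : exists d : nat, forall i (j : nat) u, (d <= j)%N ->
    gen_eigenspace (Lop (@gtw_Y _ _ _ (F i)) 0)
      (mu - j%:R / (ord_of (g1 \o g2))%:R) u -> u = 0.
  by have [d hd] := wf0 mu; exists d => i j u; exact: hd (hZ i) (sZ i).
have nf mu l1 w1 l2 w2 k :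
    gen_eigenspace (Lop (@gtw_Y _ _ _ W1) 0) l1 w1 ->
    gen_eigenspace (Lop (@gtw_Y _ _ _ W2) 0) l2 w2 ->
    exists K : nat, forall i,
    iter K (shift (Lop (@gtw_Y _ _ _ (F i)) 0) mu)
      (coef l1 w1 l2 w2 (@fp_op _ _ _ _ _ _ (F i)) mu k) = 0.
  move=> h1 h2; have [K hK] := nf0 mu; exists K => i.
  apply: (hK _ _ _ (hZ i) (sZ i)).
  exact: (io_gen hg1 hg2 fg1 fg2 (gtw_axioms (F i)) (gtm_weak (gtw_axioms W1))
    (gtm_weak (gtw_axioms W2)) (hZ i)).
have lf mu l1 w1 l2 w2 :
    gen_eigenspace (Lop (@gtw_Y _ _ _ W1) 0) l1 w1 ->
    gen_eigenspace (Lop (@gtw_Y _ _ _ W2) 0) l2 w2 ->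
    exists K : nat, forall i k, (K <= k)%N ->
    coef l1 w1 l2 w2 (@fp_op _ _ _ _ _ _ (F i)) mu k = 0.
  move=> h1 h2; have [K hK] := lf0 mu _ _ _ _ h1 h2.
  by exists K => i k; exact: hK (hZ i) (sZ i).
(* The diamond is the span of the family of all [fp_op (F i)], by conversion. *)
have gD : generalized_twisted_module (g1 \o g2) (diamond_Y F) :=
  fam_span_generalized hg1 hg2 fg1 fg2 g12 hZ wf nf.
have iD : intertwining_operator g1 g2 (@gtw_Y _ _ _ W1) (@gtw_Y _ _ _ W2)
    (diamond_Y F) (diamond_op F) :=
  fam_span_intertwining hg1 hg2 fg1 fg2 g12 hZ wf lf.
have YE := fam_span_YE hg1 hg2 fg1 fg2 g12 hZ wf.
split; [exact: YE| |].
  split=> //; exact: (fam_span_surj (fun i => @fp_op _ _ _ _ _ _ (F i))).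
split=> // M Z' hZ'.
have [p [f [[lf' fY] fZ]]] := op_image_fpair hg1 hg2 fg1 fg2 g12 hZ'.
have [i [e [[le eY] [h eK hK] eZ]]] := hF.1 p.
have lh := linear_inverse le eK hK.
have hY v n u : h (gtw_Y v n u) = gtw_Y v n (h u).
  by apply: (can_inj eK); rewrite eY !hK.
pose ev (d : diamond F) : F i := diamond_val d i.
have lev : linear ev by exact: fam_ev_linear.
have evY v n d : ev (diamond_Y F v n d) = gtw_Y v n (ev d).
  by exact: (fam_ev_Y hg1 hg2 fg1 fg2 g12 hZ wf).
have evZ w1 n k w2 : ev (diamond_op F w1 n k w2) = e (fp_op p w1 n k w2).
  by rewrite eZ.
(* Project to the factor representing the image of Z', return to that image by the inverse [h] of
   [e], and include it into M by [f]. *)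
exists (f \o h \o ev); split.
  split; first split.
  - by move=> a u v; rewrite /comp [ev _](lev a u v) lh lf'.
  - by move=> v n u; rewrite /comp evY hY fY.
  by move=> w1 n k w2; rewrite /comp evZ eK fZ.
(* Uniqueness: both maps are linear and agree on the coefficients, which span the diamond. *)
move=> phi [[lphi _] hphi]; apply/funext => d.
have : (fun d => (f \o h \o ev) d - phi d) d = 0; last first.
  by move=> /eqP; rewrite subr_eq0 => /eqP.
apply: (fam_span_ind (Z := fun i => @fp_op _ _ _ _ _ _ (F i))
  (P := [set d | (f \o h \o ev) d - phi d = 0])).
  split=> [|u v|a u]; rewrite /mkset /comp.
  - by rewrite (lin0 lev) (lin0 lh) (lin0 lf') (lin0 lphi) subrr.
  - by move=> hu hv; rewrite (linD lev) (linD lh) (linD lf') (linD lphi) opprD addrACA hu hv addr0.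
  by move=> hu; rewrite (linZ lev) (linZ lh) (linZ lf') (linZ lphi) -scalerBr hu scaler0.
move=> w1 n k w2; rewrite /mkset /comp.
by rewrite -[fam_span_op _ _ _ _ _]/(diamond_op F w1 n k w2) -hphi evZ eK fZ subrr.
Qed.
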